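(* A 6-dimensional real Lie algebra $\mathfrak{g}$ admits a flat symplectic form (i.e. a form $\omega$ such that $(\mathfrak{g},\omega)$ is a flat symplectic Lie algebra) if and only if $\mathfrak{g}$ is isomorphic to one and only one of the following Lie algebras (given in a basis $x_1,\dots,x_6$ by their non-vanishing brackets, up to skew-symmetry): \begin{itemize} \item $\mathbb{R}^6$: the abelian Lie algebra; \item $\mathbb{R}^3\times\mathfrak{h}_3$: $[x_1,x_2]=x_6$; \item $\mathfrak{g}_6^1$: $[x_1,x_2]=x_4$, $[x_1,x_3]=x_5$, $[x_2,x_3]=x_6$; \item $\mathfrak{g}_6^2$: $[x_1,x_2]=x_5$, $[x_1,x_3]=x_6$; \item $\mathfrak{g}_6^3$: $[x_1,x_2]=x_4$, $[x_1,x_3]=x_5$, $[x_1,x_4]=x_6$, $[x_2,x_3]=x_6$. \end{itemize}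
   Context: A symplectic Lie algebra $(\mathfrak{g},\omega)$ is a finite-dimensional real Lie algebra $\mathfrak{g}$ with a non-degenerate skew-symmetric bilinear form $\omega$ such that $\omega([u,v],w)+\omega([v,w],u)+\omega([w,u],v)=0$ for all $u,v,w\in\mathfrak{g}$. Its associated product $\bullet$ is defined by $\omega(u\bullet v,w)=\frac13\big(\omega([u,v],w)+\omega([u,w],v)\big)$ for all $u,v,w$; put $\mathrm{L}_uv=u\bullet v$. $(\mathfrak{g},\omega)$ is called flat (and $\omega$ a flat symplectic form) if $\mathrm{L}_{[u,v]}=\mathrm{L}_u\mathrm{L}_v-\mathrm{L}_v\mathrm{L}_u$ for all $u,v\in\mathfrak{g}$. *)

(* Defs.v *)
From HB Require Import structures.
From mathcomp Require Import all_boot all_order all_algebra.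
From mathcomp Require Import ring.

Set Implicit Arguments.
Unset Strict Implicit.
Unset Printing Implicit Defensive.

Import GRing.Theory.
Local Open Scope ring_scope.

HB.mixin Record Vector_isLieAlgebra (R : fieldType) V of Vector R V := {
  lie : V -> V -> V;
  lie_bilinear : bilinear_for *:%R *:%R lie;
  liexx : forall u, lie u u = 0;
  lie_jacobi : forall u v w,
    lie u (lie v w) + lie v (lie w u) + lie w (lie u v) = 0
}.

#[short(type="lieAlgebraType")]
HB.structure Definition LieAlgebra (R : fieldType) :=
  { V of Vector R V & Vector_isLieAlgebra R V }.

HB.instance Definition _ (R : fieldType) (g : lieAlgebraType R) :=
  bilinear_isBilinear.Build R g g g *:%R *:%R (@lie R g) lie_bilinear.

Definition lie_isomorphic (R : fieldType) (g h : lieAlgebraType R) :=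
  exists f : {linear g -> h},
    bijective f /\ forall u v, f (lie u v) = lie (f u) (f v).

Section Symplectic.
Variables (R : fieldType) (g : lieAlgebraType R) (omega : {skew_symmetric g}).

Definition symplectic :=
  nondegenerate omega /\
  forall u v w,
    omega (lie u v) w + omega (lie v w) u + omega (lie w u) v = 0.

Definition musical : 'Hom(g, 'Hom(g, R^o)) :=
  linfun (fun u => linfun (omega u : g -> R^o)).

Lemma musicalE u w : musical u w = omega u w.
Proof.
rewrite /musical.
pose h u := linfun (omega u : g -> R^o).
have hE u' w' : h u' w' = omega u' w'.
  have lin : linear (omega u' : g -> R^o) by move=> a x y; rewrite linearPr.
  pose f := HB.pack_for {linear g -> R^o} (omega u' : g -> R^o)
    (GRing.isLinear.Build _ _ _ _ (omega u' : g -> R^o) lin).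
  by rewrite /h -[omega u' w']/(f w') -(lfunE f).
have lin : linear h.
  move=> a x y; apply/lfunP => z.
  by rewrite add_lfunE scale_lfunE !hE linearPl.
pose f := HB.pack_for {linear g -> 'Hom(g, R^o)} h
    (GRing.isLinear.Build _ _ _ _ h lin).
by rewrite -[linfun _]/(linfun f) lfunE hE.
Qed.

(* u . v is the vector whose image under musical is the linear form           *)
(* w |-> (omega([u,v],w) + omega([u,w],v)) / 3; assoc_productP and            *)
(* assoc_product_uniq show that for non-degenerate omega this is the unique   *)
(* product satisfying the defining identity.                                  *)
Definition assoc_product (u v : g) : g :=
  (musical^-1)%VF
    (linfun (fun w => 3^-1 * (omega (lie u v) w + omega (lie u w) v) : R^o)).

Lemma nondegenerateP :
  reflect (forall u, (forall w, omega u w = 0) -> u = 0) (nondegenerate omega).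
Proof.
apply: (iffP eqP) => [radv0 u u0 | inj]; last first.
  apply/eqP; rewrite -subv0; apply/subvP => u /mem_orthovP uP.
  by rewrite memv0; apply/eqP/inj => w; apply/uP/memvf.
apply/eqP; rewrite -memv0 -radv0; apply/mem_orthovP => w _; exact: u0.
Qed.

Lemma assoc_productP u v w : nondegenerate omega ->
  omega (assoc_product u v) w = 3^-1 * (omega (lie u v) w + omega (lie u w) v).
Proof.
move=> /nondegenerateP nd.
have ker0 : lker musical = 0%VS.
  apply/eqP; rewrite -subv0; apply/subvP => x; rewrite memv_ker memv0 => /eqP x0.
  by apply/eqP/nd => z; rewrite -musicalE x0 zero_lfunE.
have im : limg musical = fullv.
  apply/eqP; rewrite eqEdim subvf limg_dim_eq ?ker0 ?capv0 //.
  by rewrite !dimvf /dim /= muln1.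
pose f w := 3^-1 * (omega (lie u v) w + omega (lie u w) v) : R^o.
have lin : linear f.
  move=> a x y; rewrite /f linearPr linearPr linearPl /=.
  by rewrite -[a *: _]/(a * _); ring.
pose F := HB.pack_for {linear g -> R^o} f (GRing.isLinear.Build _ _ _ _ f lin).
by rewrite -musicalE /assoc_product limg_lfunVK ?im ?memvf // -/f (lfunE F).
Qed.

Lemma assoc_product_uniq (p : g -> g -> g) : nondegenerate omega ->
  (forall u v w,
    omega (p u v) w = 3^-1 * (omega (lie u v) w + omega (lie u w) v)) ->
  p =2 assoc_product.
Proof.
move=> nd pP u v; apply/eqP; rewrite -subr_eq0; apply/eqP.
by apply: (nondegenerateP nd) => w; rewrite
  linearBl /= [X in X - _]pP [X in _ - X]assoc_productP // subrr.
Qed.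

Definition flat_symplectic :=
  symplectic /\
  forall u v w,
    assoc_product (lie u v) w =
    assoc_product u (assoc_product v w) - assoc_product v (assoc_product u w).

End Symplectic.

Variant flat6_name := R6 | R3xH3 | G6_1 | G6_2 | G6_3.

(* (i, j, k) stands for [x_i, x_j] = x_k, with the basis numbered from 1.      *)
Definition flat6_table (m : flat6_name) : seq (nat * nat * nat) :=
  match m with
  | R6    => [::]
  | R3xH3 => [:: (1, 2, 6)]
  | G6_1  => [:: (1, 2, 4); (1, 3, 5); (2, 3, 6)]
  | G6_2  => [:: (1, 2, 5); (1, 3, 6)]
  | G6_3  => [:: (1, 2, 4); (1, 3, 5); (1, 4, 6); (2, 3, 6)]
  end%N.

Definition flat6 (R : fieldType) (m : flat6_name) : Type := 'rV[R]_6.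
HB.instance Definition _ R m := Vector.on (@flat6 R m).

Section Flat6.
Variables (R : fieldType) (m : flat6_name).
Implicit Types u v w : 'rV[R]_6.

Definition basis6 (i : nat) : 'rV[R]_6 := delta_mx 0 (inord i.-1).
Definition coord6 u (i : nat) : R := u 0 (inord i.-1).

Definition flat6_lie u v : 'rV[R]_6 :=
  \sum_(t <- flat6_table m) let: (i, j, k) := t in
    (coord6 u i * coord6 v j - coord6 u j * coord6 v i) *: basis6 k.

Fact flat6_bilinear : bilinear_for *:%R *:%R flat6_lie.
Proof.
rewrite /flat6_lie; split=> [v | u] a x y /=; rewrite scaler_sumr -big_split /=;
  apply: eq_bigr => -[[i j] k] _; rewrite scalerA -scalerDl /coord6 !mxE;
  by congr (_ *: _); ring.
Qed.

Fact flat6_liexx u : flat6_lie u u = 0.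
Proof.
by rewrite /flat6_lie big1 // => -[[i j] k] _; rewrite mulrC subrr scale0r.
Qed.

Fact flat6_jacobi u v w :
  flat6_lie u (flat6_lie v w) + flat6_lie v (flat6_lie w u) +
  flat6_lie w (flat6_lie u v) = 0.
Proof.
have bE i j : (0 < i <= 6)%N -> (0 < j <= 6)%N ->
    coord6 (basis6 i) j = (i == j)%:R.
  case: i => [|i] //; case: j => [|j] //= hi hj.
  by rewrite /coord6 /basis6 mxE eqxx /= -val_eqE /= !inordK // eq_sym.
have cD x y i : coord6 (x + y) i = coord6 x i + coord6 y i by rewrite /coord6 mxE.
have cZ a x i : coord6 (a *: x) i = a * coord6 x i by rewrite /coord6 mxE.
have c0 i : coord6 0 i = 0 by rewrite /coord6 mxE.
rewrite /flat6_lie; case: m; rewrite /flat6_table ?(big_cons, big_nil) ?addr0 //.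
all: rewrite ?(cD, cZ, c0) !bE //= ?(mulr0, mulr1, addr0, add0r, subr0, sub0r).
all: rewrite ?(oppr0, subr0, scale0r, add0r, addr0) // -!scalerDl.
by rewrite [X in X *: _](_ : _ = 0) ?scale0r //; ring.
Qed.

End Flat6.

HB.instance Definition _ (R : fieldType) (m : flat6_name) :=
  Vector_isLieAlgebra.Build R (flat6 R m)
    (@flat6_bilinear R m) (@flat6_liexx R m) (@flat6_jacobi R m).

(* Main.v *)
(* Write u.v for the associated product and T(u,v,w) = omega(u.v,w): T is        *)
(* symmetric in v,w and its cyclic sum vanishes, so R_u + L_u is the adjoint of  *)
(* R_u, and flatness amounts to L_(u.v) = R_v^* R_u^* - R_u R_v.  The centre is  *)
(* the omega-orthogonal of g.g.                                                  *)
(*                                                                               *)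
(* A nonzero flat algebra has nonzero centre.  If z is orthogonal to [g,g] then  *)
(* L_(v.z) = 0, and if L_x = 0 then every u.x is central, so it suffices that g  *)
(* is not perfect.  In a perfect g, traces of words of length at most two in the *)
(* operators L_u, R_u vanish; modulo shorter words each word of length three is  *)
(* a multiple of L_u L_v L_w, with different multiples for L L R and its cyclic  *)
(* rotation L R L, so all words are traceless, long products of L_u's vanish,    *)
(* and g = g.g = g.(g.g) = ... = 0.                                              *)
(*                                                                               *)
(* A central e reduces g to the flat algebra e^perp / e, of dimension two less.  *)
(* It is trivial in dimension 2, hence explicit in dimension 4.  In dimension 6  *)
(* either g.g is contained in the centre, and g is given by an alternating map   *)
(* from R^3 to a 3-dimensional centre, classified by its rank; or g is g_6^3.    *)

Require Import Defs.
From HB Require Import structures.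
From mathcomp Require Import all_boot all_order all_algebra reals.
From mathcomp Require Import ring lra.
From mathcomp Require Import boolp.

Set Implicit Arguments.
Unset Strict Implicit.
Unset Printing Implicit Defensive.

Import Order.TTheory GRing.Theory Num.Theory.
Local Open Scope ring_scope.

(** * Matrices all of whose words are traceless *)

(** The bracket is the commutator of a left-symmetric product whose left multiplications are
    skew-adjoint for omega ([flat_product]), and the classification goes by symplectic reduction, so
    everything rests on [exists_central]. If there were no nonzero central vector,
    [not_perfect_central] would make g perfect, and by [perfect_functional] every linear form
    vanishing on commutators would be zero. This kills the traces of short words in the L_u and R_u,
    [tr_word_eq0] extends it to all words, and [traceless_word0] makes long products vanish, against
    g = g.g ([perfect_absurd]).

    Reduction by a central e leads from dimension 6 to 4 and then to 2, where the product is zero.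
    On the way back, a 4-dimensional reduction either has zero product or the normal form of
    [dim4_normal_form]. In both cases g has an explicit basis of type [G6_3], or all products are
    mutually orthogonal ([dim6_dichotomy]). As the centre is the orthogonal of g.g, orthogonality of
    products means that g.g is central, and the bracket is an alternating map from R^3 to a
    3-dimensional central subspace. Its rank 0, 1, 2 or 3 gives [R6], [R3xH3], [G6_2] or [G6_1]
    ([generators_classification]).

    Conversely each model carries an explicit flat structure ([flat6_flat]), which is pulled back
    along an isomorphism. The invariants in [flat6_type] tell the five models apart. *)

Lemma mxtrace_idem (F : fieldType) n (E : 'M[F]_n) :
  E *m E = E -> \tr E = (\rank E)%:R.
Proof.
rewrite -{1 2 3 4}(mulmx_base E) mulmxA -(mulmxA (col_base E)) => EE.
have : col_base E *m (row_base E *m col_base E) = col_base E *m 1%:M.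
  by rewrite mulmx1; apply: (row_free_inj (row_base_free E)).
move/(row_full_inj (col_base_full E)) => BC1.
by rewrite mxtrace_mulC BC1 mxtrace1.
Qed.

(** Write the characteristic polynomial as q X^m with q(0) nonzero. The projector E onto the part
    where A is invertible is a polynomial in A without constant term, so it has trace 0, hence rank
    0 in characteristic zero. *)
Lemma mxtrace_expn_nilpotent (F : numFieldType) n (A : 'M[F]_n.+1) :
  (forall k, \tr (A ^+ k.+1) = 0) -> exists k, A ^+ k = 0.
Proof.
move=> trA; have [m [q q0 pE]] := multiplicity_XsubC (char_poly A) 0.
have {}q0 : ~~ root q 0.
  by move: q0; rewrite monic_neq0 ?char_poly_monic.
have pA : horner_mx A (char_poly A) = 0 by apply: Cayley_Hamilton.
rewrite subr0 in pE.
(* The exponent m+1 rather than m keeps the constant term of u X^(m+1) zero even when m = 0. *)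
have : coprimep ('X^(m.+1)) q.
  by rewrite coprimep_sym coprimep_expr // -(subr0 'X) coprimep_XsubC.
case/Bezout_eq1_coprimepP => -[u v] /= uv1.
pose E := horner_mx A (u * 'X^(m.+1)).
have EE : E *m E = E.
  have : E * (1 - E) = 0.
    rewrite -[1](rmorph1 (horner_mx A)) -rmorphB -rmorphM /=.
    rewrite -{1}uv1 addrAC subrr add0r.
    have -> : u * 'X^(m.+1) * (v * q) = u * v * 'X * char_poly A.
      by rewrite pE exprS; ring.
    by rewrite rmorphM /= pA mulr0.
  move/eqP; rewrite mulrBr mulr1 subr_eq0 => /eqP EE.
  by rewrite -[LHS]/(E * E) -EE.
have trE : \tr E = 0.
  rewrite /E -{1}[u]coefK poly_def mulr_suml rmorph_sum raddf_sum big1 //= => i _.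
  by rewrite -scalerAl -exprD linearZ rmorphXn /= horner_mx_X mxtraceZ addnS trA mulr0.
have E0 : E = 0.
  by apply/eqP; rewrite -mxrank_eq0 -(eqr_nat F) -mxtrace_idem ?trE.
exists m; transitivity (horner_mx A ('X^m * (u * 'X^(m.+1) + v * q))).
  by rewrite uv1 mulr1 rmorphXn /= horner_mx_X.
rewrite mulrDr rmorphD /= rmorphM /= -/E E0 mulr0 add0r.
by rewrite mulrCA [_ * q]mulrC -pE rmorphM /= pA mulr0.
Qed.

Section TracelessWords.
Variables (F : numFieldType) (n : nat) (I : Type) (M : I -> 'M[F]_n.+1).

Definition word (s : seq I) := \prod_(i <- s) M i.

Hypothesis tr0 : forall s, (0 < size s)%N -> \tr (word s) = 0.

(** The algebra without unit generated by the M_i; the empty word stays out because the identity has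
    nonzero trace. *)
Inductive words_span : 'M[F]_n.+1 -> Prop :=
| WordsSpanWord s : (0 < size s)%N -> words_span (word s)
| WordsSpanLin a x y : words_span x -> words_span y -> words_span (a *: x + y).

Lemma words_spanM x y : words_span x -> words_span y -> words_span (x * y).
Proof.
move=> wx; elim: wx y => [s s0 y | a {}x z _ IHx _ IHz y wy]; last first.
  by rewrite mulrDl -scalerAl; apply: WordsSpanLin; [apply: IHx | apply: IHz].
elim=> [t t0 | a {}y z _ IHy _ IHz]; last first.
  by rewrite mulrDr -scalerAr; apply: WordsSpanLin.
rewrite /word -big_cat; apply: WordsSpanWord; rewrite size_cat.
by rewrite addn_gt0 s0.
Qed.

Lemma words_span_tr x : words_span x -> \tr x = 0.
Proof.
by elim=> [s /tr0 // | a y z _ y0 _ z0]; rewrite mxtraceD mxtraceZ y0 z0 mulr0 addr0.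
Qed.

Lemma words_span_nilpotent x : words_span x -> exists k, x ^+ k = 0.
Proof.
move=> wx; apply: mxtrace_expn_nilpotent => k; apply: words_span_tr.
by elim: k => [|k IHk]; rewrite ?expr1 // exprS; apply: words_spanM.
Qed.

Fixpoint prefix_span (s : seq I) (y : 'rV[F]_n.+1) : 'M[F]_n.+1 :=
  if s is i :: s' then (y + prefix_span s' (y *m M i))%MS else <<y>>%MS.

(** Only the M_i b, not b itself, are combinations of nonempty words: b may contain a multiple of
    the identity. *)
Lemma prefix_spanP s y v : (v <= prefix_span s y)%MS ->
  exists2 b, v = y *m b & forall i, words_span (M i * b).
Proof.
have word1 i : words_span (M i).
  have <- : word [:: i] = M i by rewrite /word big_seq1.
  exact: WordsSpanWord.
elim: s y v => [|i s IHs] y v /=.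
  rewrite genmxE => /sub_rVP [a ->]; exists a%:M; first by rewrite mul_mx_scalar.
  move=> i; rewrite -[_ * _]/(_ *m _) mul_mx_scalar.
  have -> : a *: M i = (a - 1) *: M i + M i by rewrite -{3}[M i]scale1r -scalerDl subrK.
  exact: WordsSpanLin.
case/sub_addsmxP => -[c d] /= ->.
have /IHs [b -> wb] : (d *m prefix_span s (y *m M i) <= prefix_span s (y *m M i))%MS.
  exact: submxMl.
exists ((c 0 0)%:M + M i * b).
  by rewrite mulmxDr mul_mx_scalar {1}[c]mx11_scalar mul_scalar_mx !mulmxA.
move=> j; rewrite mulrDr -[_ * _%:M]/(_ *m _) mul_mx_scalar.
by apply: WordsSpanLin => //; apply: words_spanM.
Qed.

(* A vector y lying in the span of its proper images y M_i ... is y = y b with *)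
(* b nilpotent, hence zero; so the successive images of y under the letters    *)
(* of a word are linearly independent until they vanish.                       *)
Lemma prefix_span_rank s y :
  y *m word s != 0 -> (size s < \rank (prefix_span s y))%N.
Proof.
elim: s y => [|i s IHs] y /=.
  by rewrite /word big_nil mulmx1 genmxE rank_rV => ->.
rewrite /word big_cons -[_ * _]/(_ *m _) mulmxA => ys0; have := IHs _ ys0.
move/leq_ltn_trans => -> //.
rewrite ltn_neqAle mxrankS ?addsmxSr // andbT.
apply: contra_neqN ys0 => /eqP req.
have : (y <= prefix_span s (y *m M i))%MS.
  rewrite (submx_trans (addsmxSl y (prefix_span s (y *m M i)))) //.
  by rewrite -(geq_leqif (mxrank_leqif_sup (addsmxSr _ _))) req.
case/prefix_spanP => b yE wb.
have [k bk0] := words_span_nilpotent (wb i).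
have yk j : y = y *m (M i * b) ^+ j.
  elim: j => [|j IHj]; first by rewrite expr0 mulmx1.
  by rewrite exprSr -[_ * (_ * _)]/(_ *m (_ *m _)) mulmxA -IHj mulmxA.
by rewrite [y](yk k) bk0 mulmx0 !mul0mx.
Qed.

(** A nonzero row of the word would produce n+2 independent vectors in dimension n+1. *)
Lemma traceless_word0 s : size s = n.+1 -> word s = 0.
Proof.
move=> sn; apply/row_matrixP => i; rewrite row0 rowE.
apply/eqP; apply: contraT => /prefix_span_rank.
by rewrite sn ltnNge rank_leq_row.
Qed.

End TracelessWords.

(** * Linear relations between words in three letters *)

Section TripleWords.
Variables (F : realFieldType) (V : Type).
(* [t a b c u v w] stands for the trace of a word starting with three operators, *)
(* the bits telling L (true) from R (false); the hypotheses are the relations    *)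
(* between words of length two modulo shorter words.                             *)
Variable t : bool -> bool -> bool -> V -> V -> V -> F.
Hypothesis tLLx : forall c u v w, t true true c u v w = t true true c v u w.
Hypothesis txLL : forall c u v w, t c true true u v w = t c true true u w v.
Hypothesis tRRx : forall c u v w,
  t false false c u v w = t false true c u v w - t true false c v u w.
Hypothesis txRR : forall c u v w,
  t c false false u v w = t c false true u v w - t c true false u w v.
Hypothesis tSSx : forall c u v w,
  t true true c u v w + t true false c u v w + t false true c u v w
  + t false false c u v w - t false false c v u w = 0.
Hypothesis txSS : forall c u v w,
  t c true true u v w + t c true false u v w + t c false true u v w
  + t c false false u v w - t c false false u w v = 0.

Definition triple_coef (a b c : bool) : F :=
  match a, b, c with
  | true, true, true => 1
  | true, true, false | false, true, true => - (2 / 3)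
  | true, false, true => - (1 / 3)
  | false, false, false => 0
  | _, _, _ => 1 / 3
  end.

(** The relations at all permutations of u, v, w form a linear system that expresses every pattern
    through the pattern LLL with the same arguments. *)
Lemma triple_word a b c u v w :
  t a b c u v w = triple_coef a b c * t true true true u v w.
Proof.
have E u' v' w' d := (tLLx d u' v' w', txLL d u' v' w', tRRx d u' v' w',
  txRR d u' v' w', tSSx d u' v' w', txSS d u' v' w').
move: (E u v w true) (E u v w false) (E u w v true) (E u w v false)
  (E v u w true) (E v u w false) (E v w u true) (E v w u false)
  (E w u v true) (E w u v false) (E w v u true) (E w v u false).
do 12!case=> [[[[[? ?] ?] ?] ?] ?].
by case: a b c => [] [] []; rewrite /triple_coef; lra.
Qed.
End TripleWords.

(** * Flat symplectic products *)

(** The axioms mention only the form and the product, the Lie bracket being the commutator; in this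
    shape they pass to symplectic reductions and pull back along linear isomorphisms. [fp_sym] says
    that L_u is skew-adjoint, and [fp_lsa] is flatness for the commutator. *)
Record flat_product (R : realFieldType) (V : vectType R)
    (om : V -> V -> R) (pr : V -> V -> V) : Prop := FlatProduct {
  fp_om_linl : forall w a u v, om (a *: u + v) w = a * om u w + om v w;
  fp_om_skew : forall u v, om u v = - om v u;
  fp_om_nondeg : forall u, (forall w, om u w = 0) -> u = 0;
  fp_linl : forall w a u v, pr (a *: u + v) w = a *: pr u w + pr v w;
  fp_linr : forall w a u v, pr w (a *: u + v) = a *: pr w u + pr w v;
  fp_sym : forall u v w, om (pr u v) w = om (pr u w) v;
  fp_cyc : forall u v w, om (pr u v) w + om (pr v w) u + om (pr w u) v = 0;
  fp_lsa : forall u v w,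
    pr u (pr v w) - pr (pr u v) w = pr v (pr u w) - pr (pr v u) w
}.

Section FlatProduct.
Variables (R : realFieldType) (V : vectType R).
Variables (om : V -> V -> R) (pr : V -> V -> V).
Hypothesis fp : flat_product om pr.
Local Notation "u ∘ v" := (pr u v) (at level 40, left associativity).

Let om_linl := fp_om_linl fp.
Let om_skew := fp_om_skew fp.
Let pr_linl := fp_linl fp.
Let pr_linr := fp_linr fp.

Lemma omDl u v w : om (u + v) w = om u w + om v w.
Proof. by rewrite -{1}[u]scale1r om_linl mul1r. Qed.
Lemma om0l w : om 0 w = 0.
Proof. by have := omDl 0 0 w; rewrite addr0; lra. Qed.
Lemma omZl a u w : om (a *: u) w = a * om u w.
Proof. by rewrite -[a *: u]addr0 om_linl om0l addr0. Qed.
Lemma omNl u w : om (- u) w = - om u w.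
Proof. by rewrite -scaleN1r omZl mulN1r. Qed.
Lemma omDr u v w : om w (u + v) = om w u + om w v.
Proof. by rewrite !(om_skew w) omDl opprD. Qed.
Lemma omZr a u w : om w (a *: u) = a * om w u.
Proof. by rewrite !(om_skew w) omZl mulrN. Qed.
Lemma omNr u w : om w (- u) = - om w u.
Proof. by rewrite !(om_skew w) omNl. Qed.
Lemma om0r w : om w 0 = 0.
Proof. by rewrite om_skew om0l oppr0. Qed.
Definition omE := (omDl, omDr, omNl, omNr, omZl, omZr, om0l, om0r).

Lemma omuu u : om u u = 0.
Proof. by have := om_skew u u; lra. Qed.

Lemma om_inj x y : (forall w, om x w = om y w) -> x = y.
Proof.
move=> xy; apply/eqP; rewrite -subr_eq0; apply/eqP/(fp_om_nondeg fp) => w.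
by rewrite !omE xy subrr.
Qed.

Lemma prDl u v w : (u + v) ∘ w = u ∘ w + v ∘ w.
Proof. by rewrite -{1}[u]scale1r pr_linl scale1r. Qed.
Lemma pr0l w : 0 ∘ w = 0.
Proof. by apply: (@addrI _ (0 ∘ w)); rewrite -prDl !addr0. Qed.
Lemma prZl a u w : (a *: u) ∘ w = a *: (u ∘ w).
Proof. by rewrite -[a *: u]addr0 pr_linl pr0l addr0. Qed.
Lemma prNl u w : (- u) ∘ w = - (u ∘ w).
Proof. by rewrite -scaleN1r prZl scaleN1r. Qed.
Lemma prDr u v w : w ∘ (u + v) = w ∘ u + w ∘ v.
Proof. by rewrite -{1}[u]scale1r pr_linr scale1r. Qed.
Lemma pr0r w : w ∘ 0 = 0.
Proof. by apply: (@addrI _ (w ∘ 0)); rewrite -prDr !addr0. Qed.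
Lemma prZr a u w : w ∘ (a *: u) = a *: (w ∘ u).
Proof. by rewrite -[a *: u]addr0 pr_linr pr0r addr0. Qed.
Lemma prNr u w : w ∘ (- u) = - (w ∘ u).
Proof. by rewrite -scaleN1r prZr scaleN1r. Qed.
Definition prE := (prDl, prDr, prNl, prNr, prZl, prZr, pr0l, pr0r).

Definition bracket u v := u ∘ v - v ∘ u.

Lemma om_adjL u v w : om (u ∘ v) w = - om v (u ∘ w).
Proof. by rewrite (fp_sym fp) om_skew. Qed.

Lemma om_adjR u v w : om (u ∘ v) w = om u (v ∘ w + w ∘ v).
Proof.
rewrite omDr; have := fp_cyc fp u v w; rewrite (fp_sym fp w u).
by rewrite (om_skew (v ∘ w)) (om_skew (w ∘ v)); lra.
Qed.

(* Flatness as L_(u v) = R_v^* R_u^* - R_u R_v, where R_u^* = L_u + R_u. *)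
Lemma prA u v x : (u ∘ v) ∘ x =
  v ∘ (u ∘ x + x ∘ u) + (u ∘ x + x ∘ u) ∘ v - (x ∘ v) ∘ u.
Proof.
move: u v => v u; apply: om_inj => w.
have e0 := om_adjR x (u ∘ v) w; have e0' := om_adjL (u ∘ v) x w.
have e1 : om x ((w ∘ u) ∘ v) = om (u ∘ (v ∘ x + x ∘ v) + (v ∘ x + x ∘ v) ∘ u) w.
  by rewrite om_skew !om_adjR -om_skew.
have e2 : om x (u ∘ (w ∘ v)) = - om (v ∘ (u ∘ x) + (u ∘ x) ∘ v) w.
  by rewrite om_skew om_adjL opprK om_adjR om_skew omDl.
have e3 : om x ((u ∘ w) ∘ v) = - om (u ∘ (v ∘ x + x ∘ v)) w.
  by rewrite om_skew om_adjR om_adjL opprK om_skew.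
have := congr1 (om^~ w) (fp_lsa fp x u v); have := congr1 (om x) (fp_lsa fp w u v).
have := congr1 (om^~ w) (fp_lsa fp u v x).
move: e0 e0' e1 e2 e3; rewrite !prE !omE => e0 e0' e1 e2 e3; lra.
Qed.

Definition central z := forall u, u ∘ z = 0.

Lemma central_l z u : central z -> z ∘ u = 0.
Proof.
move=> zZ; apply: om_inj => w.
by rewrite om_adjR omDr !(om_skew z) !om_adjL !zZ !om0r !om0l; lra.
Qed.

(** If L_x = 0, left symmetry gives L_(y.x) = 0, and then [prA] gives v.(y.x) = (y.v).x and (v.y +
    y.v).x = 0. So (y.v).x is skew in y and v, while left symmetry makes it symmetric. *)
Lemma kerL_central x u : (forall v, x ∘ v = 0) -> central (u ∘ x).
Proof.
move=> xK w.
have kerxx y v : (y ∘ x) ∘ v = 0.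
  by apply/oppr_inj; have := fp_lsa fp y x v; rewrite !xK pr0r pr0l !subr0 sub0r oppr0.
have E1 y v : v ∘ (y ∘ x) = (y ∘ v) ∘ x.
  have := prA x v y; rewrite !xK !add0r kerxx addr0 pr0l => /esym/eqP.
  by rewrite subr_eq0 => /eqP.
have E2 y v : (v ∘ y + y ∘ v) ∘ x = 0.
  by have := prA v x y; rewrite !kerxx xK add0r subr0.
have E3 := fp_lsa fp w u x; apply: om_inj => z.
have := congr1 (om^~ z) E3; have := congr1 (om^~ z) (E2 w u).
have := congr1 (om^~ z) (E1 w u); have := congr1 (om^~ z) (E1 u w).
by rewrite !prE !omE; lra.
Qed.

(* Orthogonality to [g,g] makes R_z skew-adjoint, so L_z = - 2 R_z; flatness then *)
(* gives [L_v, R_z] = 0 and thus L_(v.z) = 0.                                     *)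
Lemma bracket_orth_kerL z v : (forall u w, om (bracket u w) z = 0) ->
  forall x, (v ∘ z) ∘ x = 0.
Proof.
move=> zP x.
have zE u : z ∘ u = - 2 *: (u ∘ z).
  apply: om_inj => w; have := zP w u; have := fp_cyc fp z u w.
  by rewrite /bracket !omE (fp_sym fp u w) (fp_sym fp w z); lra.
apply: om_inj => w.
have := congr1 (om^~ w) (prA z v x); have := congr1 (om^~ w) (prA v z x).
have := congr1 (om^~ w) (fp_lsa fp z v x).
by rewrite !(prE, zE) !omE; lra.
Qed.

(** One of z, v.z and u.(v.z) is nonzero and central: [bracket_orth_kerL] makes the left
    multiplication by v.z vanish, and [kerL_central] does the rest. *)
Lemma not_perfect_central z : z != 0 ->
  (forall u w, om (bracket u w) z = 0) -> exists2 y, y != 0 & central y.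
Proof.
move=> z0 zP; have [zZ|] := pselect (central z); first by exists z.
move=> /existsNP [v /eqP vz0]; have xK := bracket_orth_kerL v zP.
have [xZ|] := pselect (central (v ∘ z)); first by exists (v ∘ z).
move=> /existsNP [u /eqP uvz0]; exists (u ∘ (v ∘ z)) => //.
exact: kerL_central.
Qed.

End FlatProduct.

(** * A flat symplectic Lie algebra is not perfect *)

Section MatrixOf.
Variables (R : fieldType) (V : vectType R) (n : nat) (X : n.-tuple V).
Hypothesis basX : basis_of fullv X.

Definition mxOf (f : V -> V) : 'M[R]_n := \matrix_(i, j) coord X i (f X`_j).

Let XE v : v = \sum_(i < n) coord X i v *: X`_i.
Proof. by exact: (coord_basis basX (memvf _)). Qed.

Lemma linear_sum_coord (f : V -> V) : linear f ->
  forall v, f v = \sum_(i < n) coord X i v *: f X`_i.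
Proof.
move=> lf v.
have [f0 fD fZ] : [/\ f 0 = 0, (forall x y, f (x + y) = f x + f y)
    & forall a x, f (a *: x) = a *: f x].
  have f0 : f 0 = 0.
    by apply: (@addrI _ (f 0)); rewrite addr0 -{1}[f 0]scale1r -lf scale1r addr0.
  split=> // [x y|a x]; first by rewrite -{1}[x]scale1r lf scale1r.
  by rewrite -[a *: x]addr0 lf f0 addr0.
by rewrite {1}[v]XE (big_morph f fD f0); apply: eq_bigr => i _; rewrite fZ.
Qed.

Lemma mxOf_comp f g : linear f -> mxOf (fun x => f (g x)) = mxOf f *m mxOf g.
Proof.
move=> lf; apply/matrixP => i j; rewrite !mxE (linear_sum_coord lf) linear_sum /=.
by apply: eq_bigr => k _; rewrite linearZ /= !mxE mulrC.
Qed.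

Lemma eq_mxOf f g : f =1 g -> mxOf f = mxOf g.
Proof. by move=> fg; apply/matrixP => i j; rewrite !mxE fg. Qed.

Lemma mxOfD f g : mxOf (fun x => f x + g x) = mxOf f + mxOf g.
Proof. by apply/matrixP => i j; rewrite !mxE linearD. Qed.

Lemma mxOfB f g : mxOf (fun x => f x - g x) = mxOf f - mxOf g.
Proof. by apply/matrixP => i j; rewrite !mxE linearB. Qed.

Lemma mxOfZ a f : mxOf (fun x => a *: f x) = a *: mxOf f.
Proof. by apply/matrixP => i j; rewrite !mxE linearZ. Qed.

End MatrixOf.

Section Perfect.
Variables (R : realFieldType) (V : vectType R).
Variables (om : V -> V -> R) (pr : V -> V -> V).
Hypothesis fp : flat_product om pr.
Local Notation "u ∘ v" := (pr u v) (at level 40, left associativity).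
Variables (n : nat) (X : n.+1.-tuple V).
Hypothesis basX : basis_of fullv X.


Let XE v : v = \sum_(i < n.+1) coord X i v *: X`_i.
Proof. exact: (coord_basis basX (memvf _)). Qed.

Let omsuml (a : 'I_n.+1 -> R) y :
  om (\sum_i a i *: X`_i) y = \sum_i a i * om X`_i y.
Proof.
rewrite (big_morph (om^~ y) (fun u v => omDl fp u v y) (om0l fp y)).
by apply: eq_bigr => i _; rewrite (omZl fp).
Qed.

Let omsumr (a : 'I_n.+1 -> R) y :
  om y (\sum_i a i *: X`_i) = \sum_i a i * om y X`_i.
Proof.
rewrite (big_morph (om y) (fun u v => omDr fp u v y) (om0r fp y)).
by apply: eq_bigr => i _; rewrite (omZr fp).
Qed.

Definition gram : 'M[R]_n.+1 := \matrix_(i, j) om X`_i X`_j.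

Lemma gram_unit : gram \in unitmx.
Proof.
rewrite -row_free_unit; apply: inj_row_free => v vG.
have: \sum_i v 0 i *: X`_i = 0.
  apply: (fp_om_nondeg fp) => w; rewrite [w]XE omsumr big1 // => j _.
  have := congr1 (fun M : 'rV_n.+1 => M 0 j) vG; rewrite !mxE => vGj.
  rewrite omsuml (_ : \sum_i _ = 0) ?mulr0 // -[RHS]vGj.
  by apply: eq_bigr => i _; rewrite mxE.
move=> v0; apply/rowP => i; rewrite mxE.
by have := coord_sum_free (fun j => v 0 j) i (basis_free basX); rewrite v0 linear0.
Qed.

Lemma om_represents (phi : V -> R) : (forall a u v, phi (a *: u + v) = a * phi u + phi v) ->
  exists h, forall u, phi u = om u h.
Proof.
move=> phil.
have phi0 : phi 0 = 0 by have := phil 1 0 0; rewrite scale1r addr0; lra.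
have phiD u v : phi (u + v) = phi u + phi v by rewrite -{1}[u]scale1r phil mul1r.
have phiZ a u : phi (a *: u) = a * phi u by rewrite -[_ *: _]addr0 phil phi0 addr0.
pose p : 'cV_n.+1 := \col_i phi X`_i; pose c := invmx gram *m p.
have cE : gram *m c = p by rewrite mulmxA mulmxV ?gram_unit // mul1mx.
exists (\sum_i c i 0 *: X`_i) => u; rewrite [u]XE omsuml (big_morph phi phiD phi0).
apply: eq_bigr => i _; rewrite phiZ omsumr; congr (_ * _).
have := congr1 (fun M : 'cV_n.+1 => M i 0) cE; rewrite !mxE => <-.
by apply: eq_bigr => j _; rewrite mxE mulrC.
Qed.

(** The Gram matrix conjugates the transpose of one matrix into the other. *)
Lemma mxtrace_adjoint (f g : V -> V) : linear f -> linear g ->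
  (forall x y, om (f x) y = om x (g y)) -> \tr (mxOf X f) = \tr (mxOf X g).
Proof.
move=> lf lg fg.
have GE : (mxOf X f)^T *m gram = gram *m mxOf X g.
  apply/matrixP => i j; rewrite !mxE; transitivity (om (f X`_i) X`_j).
    by rewrite [f _]XE omsuml; apply: eq_bigr => k _; rewrite !mxE.
  by rewrite fg [g _]XE omsumr; apply: eq_bigr => k _; rewrite !mxE mulrC.
rewrite -mxtrace_tr -[_^T](mulmxK gram_unit) GE mxtrace_mulC mulmxA.
by rewrite mulVmx ?gram_unit // mul1mx.
Qed.

Local Notation letter := (bool * V)%type.
Definition mulop (a : letter) x := if a.1 then a.2 ∘ x else x ∘ a.2.
Definition adjop (a : letter) x := if a.1 then - (a.2 ∘ x) else a.2 ∘ x + x ∘ a.2.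
Definition mulmat a := mxOf X (mulop a).
Local Notation L u := (mulmat (true, u)).
Local Notation S u := (mulmat (false, u)).

Lemma mulop_linear a : linear (mulop a).
Proof. by case: a => -[] u k x y; rewrite /mulop /= !(prE fp). Qed.

Lemma adjopP a x y : om (mulop a x) y = om x (adjop a y).
Proof.
case: a => -[] u; rewrite /mulop /adjop /=; last exact: (om_adjR fp).
by rewrite (om_adjL fp) (omNr fp).
Qed.

Lemma adjop_linear a : linear (adjop a).
Proof.
move=> k x y; apply: (om_inj fp) => w; rewrite (fp_om_linl fp).
rewrite ![om (adjop _ _) w](fp_om_skew fp) -!adjopP (omDr fp) (omZr fp); lra.
Qed.

Definition adjmat (a : letter) : 'M_n.+1 := if a.1 then - L a.2 else L a.2 + S a.2.

Lemma adjmatE a : mxOf X (adjop a) = adjmat a.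
Proof.
case: a => -[] u; rewrite /adjmat /= -?scaleN1r -?mxOfZ -?mxOfD; apply: eq_mxOf => x //.
by rewrite scaleN1r.
Qed.

Lemma tr_adj2 a b : \tr (mulmat a * mulmat b) = \tr (adjmat b * adjmat a).
Proof.
rewrite -!adjmatE -![_ * _]/(_ *m _) /mulmat.
rewrite -(mxOf_comp basX) -?(mxOf_comp basX) //; try exact: adjop_linear; try exact: mulop_linear.
apply: mxtrace_adjoint => [k x y|k x y|x y]; rewrite ?mulop_linear ?adjop_linear //.
by rewrite !adjopP.
Qed.

Lemma tr_adj3 a b c : \tr (mulmat a * mulmat b * mulmat c) =
  \tr (adjmat c * adjmat b * adjmat a).
Proof.
rewrite -!adjmatE -![_ * _]/(_ *m _) /mulmat.
rewrite -!(mxOf_comp basX); try exact: adjop_linear; try exact: mulop_linear.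
- apply: mxtrace_adjoint => [k x y|k x y|x y]; rewrite ?mulop_linear ?adjop_linear //.
  by rewrite !adjopP.
- by move=> k x y; rewrite !adjop_linear.
- by move=> k x y; rewrite !mulop_linear.
Qed.

End Perfect.

Section PerfectTraces.
Variables (R : realFieldType) (V : vectType R).
Variables (om : V -> V -> R) (pr : V -> V -> V).
Hypothesis fp : flat_product om pr.
Variables (n : nat) (X : n.+1.-tuple V).
Hypothesis basX : basis_of fullv X.
Hypothesis perfect : forall z, (forall u w, om (bracket pr u w) z = 0) -> z = 0.
Local Notation "u ∘ v" := (pr u v) (at level 40, left associativity).
Local Notation L u := (mulmat pr X (true, u)).
Local Notation S u := (mulmat pr X (false, u)).

Lemma mulmatP k b u v :
  mulmat pr X (b, k *: u + v) = k *: mulmat pr X (b, u) + mulmat pr X (b, v).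
Proof.
rewrite -mxOfZ -mxOfD; apply: eq_mxOf => x; rewrite /mulop /=.
by case: b; rewrite !(prE fp).
Qed.

Let mulE a b : mulmat pr X a * mulmat pr X b = mxOf X (fun x => mulop pr a (mulop pr b x)).
Proof. by rewrite -[LHS]/(mxOf _ _ *m mxOf _ _) -(mxOf_comp basX) //; apply: (mulop_linear fp). Qed.

Lemma mulmat_comm u v : L u * L v - L v * L u = L (u ∘ v) - L (v ∘ u).
Proof.
rewrite !mulE -!mxOfB; apply: eq_mxOf => x; rewrite /mulop /=.
apply: (om_inj fp) => w; have := congr1 (om^~ w) (fp_lsa fp u v x).
by rewrite !(omE fp); lra.
Qed.

Lemma mulmatR u v : S (u ∘ v) = S v * S u + L u * S v - S v * L u.
Proof.
rewrite !mulE -mxOfD -!mxOfB; apply: eq_mxOf => x; rewrite /mulop /=.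
apply: (om_inj fp) => w; have := congr1 (om^~ w) (fp_lsa fp u x v).
by rewrite !(omE fp); lra.
Qed.

Lemma mulmatL u v :
  L (u ∘ v) = L v * L u + L v * S u + S v * L u + S v * S u - S u * S v.
Proof.
rewrite !mulE -!mxOfD -!mxOfB; apply: eq_mxOf => x; rewrite /mulop /=.
by rewrite (prA fp) !(prE fp) addrA.
Qed.

(** The way perfectness is used: phi is omega(-, h) for some h, and vanishing on commutators makes h
    orthogonal to [g,g]. *)
Lemma perfect_functional (phi : V -> R) :
  (forall a u v, phi (a *: u + v) = a * phi u + phi v) ->
  (forall u v, phi (u ∘ v) = phi (v ∘ u)) -> forall u, phi u = 0.
Proof.
move=> phil phiC; have [h hE] := om_represents fp basX phil.
suff h0 : h = 0 by move=> u; rewrite hE h0 (om0r fp).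
by apply: perfect => u v; rewrite /bracket !(omE fp) -!hE phiC subrr.
Qed.

Let trC A B : \tr (A * B : 'M[R]_n.+1) = \tr (B * A).
Proof. exact: mxtrace_mulC. Qed.

Let tr_lin b (A : 'M[R]_n.+1) k u v :
  \tr (mulmat pr X (b, k *: u + v) * A) =
  k * \tr (mulmat pr X (b, u) * A) + \tr (mulmat pr X (b, v) * A).
Proof. by rewrite mulmatP mulrDl -scalerAl mxtraceD mxtraceZ. Qed.

Lemma tr_L u : \tr (L u) = 0.
Proof.
have := mxtrace_adjoint fp basX (mulop_linear fp (true, u))
  (adjop_linear fp (true, u)) (adjopP fp (true, u)).
by rewrite adjmatE /adjmat /= /mulmat -scaleN1r mxtraceZ; lra.
Qed.

(** By [mulmatR] the trace of R_(u.v) is that of R_v R_u, which is symmetric in u and v. *)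
Lemma tr_S u : \tr (S u) = 0.
Proof.
apply: (perfect_functional (phi := fun u => \tr (S u))) => [a {}u v|{}u v].
  by have := tr_lin false 1 a u v; rewrite !mulr1.
by rewrite !mulmatR !linearB !linearD /= trC [\tr (L u * _)]trC [\tr (L v * _)]trC; lra.
Qed.

Let tr_SS u v : \tr (S u * S v) = 0.
Proof.
have := tr_S (v ∘ u); rewrite mulmatR linearB linearD /= [\tr (L v * _)]trC.
by lra.
Qed.

Let tr_LS u v : \tr (L u * S v) = - (1 / 2) * \tr (L u * L v).
Proof.
have := tr_adj2 fp basX (true, u) (false, v).
rewrite /adjmat /= mulrN mulrDl linearN linearD /=.
by rewrite [\tr (L v * _)]trC [\tr (S v * _)]trC; lra.
Qed.

Let tr3C (a b c : bool * V) : \tr (mulmat pr X a * mulmat pr X b * mulmat pr X c) =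
  \tr (mulmat pr X b * mulmat pr X c * mulmat pr X a).
Proof. by rewrite -mulrA trC. Qed.

(* For b(u,v) = tr (L_u L_v), the traces of all words of length three are linear *)
(* in the numbers b(w, u.v), and the relations among them leave b(w, [u,v]) = 0. *)
Let tr_LLcomm w u v : \tr (L w * L (u ∘ v)) = \tr (L w * L (v ∘ u)).
Proof.
pose T (a b c : bool) u v w :=
  \tr (mulmat pr X (a, u) * mulmat pr X (b, v) * mulmat pr X (c, w)).
pose q w u v := \tr (L w * L (u ∘ v)).
have TC a b c x y z : T a b c x y z = T b c a y z x by apply: tr3C.
have q1 x y z : q z x y = T true true true z y x + T true true false z y x
   + T true false true z y x + T true false false z y x - T true false false z x y.
  by rewrite /q mulmatL mulrBr !mulrDr !mulrA !(linearB, linearD).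
have q2 x y z : - (1 / 2) * q z x y = T false true true z y x + T false true false z y x
   + T false false true z y x + T false false false z y x - T false false false z x y.
  have <- : \tr (S z * L (x ∘ y)) = - (1 / 2) * q z x y.
    by rewrite trC tr_LS /q trC.
  by rewrite /q mulmatL mulrBr !mulrDr !mulrA !(linearB, linearD).
have q3 x y z : - (1 / 2) * q z x y = T true false false z y x + T true true false z x y
    - T true false true z y x.
  rewrite /q -tr_LS mulmatR mulrBr mulrDr !mulrA.
  by rewrite linearB linearD.
have q4 x y z : 0 = T false false false z y x + T false true false z x y
    - T false false true z y x.
  by rewrite -(tr_SS z (x ∘ y)) mulmatR mulrBr mulrDr !mulrA linearB linearD.
have a1 x y z : T true true true x y z = - T true true true z y x.
  by rewrite /T (tr_adj3 fp basX) /adjmat /= !(mulNr, mulrN) !linearN /= opprK.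
have a2 x y z : T true true false x y z = T true true true z y x + T false true true z y x.
  by rewrite /T (tr_adj3 fp basX) /adjmat /= !(mulNr, mulrN) opprK !mulrDl linearD.
have a3 x y z : T true false false x y z = - (T true true true z y x + T true false true z y x
     + T false true true z y x + T false false true z y x).
  rewrite /T (tr_adj3 fp basX) /adjmat /= !(mulNr, mulrN) linearN /=.
  by rewrite !(mulrDl, mulrDr) !linearD /= !addrA; congr (- _); ring.
have q5 x y z : q z x y - q z y x = T true true true z x y - T true true true z y x.
  by rewrite /q /T -!linearB /= -!mulrA -!mulrBr mulmat_comm.
have q6 x y z : - (1 / 2) * (q z x y - q z y x) = T false true true z x y
    - T false true true z y x.
  have qE x' y' : - (1 / 2) * q z x' y' = \tr (S z * L (x' ∘ y')) by rewrite trC tr_LS /q trC.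
  by rewrite mulrBr !qE /T -!linearB /= -!mulrA -!mulrBr mulmat_comm.
have E x y z := (q1 x y z, q2 x y z, q3 x y z, q4 x y z, a1 x y z, a2 x y z, a3 x y z,
  q5 x y z, q6 x y z).
rewrite -/(q w u v) -/(q w v u).
move: (E u v w) (E u w v) (E v u w) (E v w u) (E w u v) (E w v u).
rewrite !(TC true false true) !(TC false true true) !(TC false false true).
rewrite !(TC false true false).
do 6!case=> [[[[[[[[? ?] ?] ?] ?] ?] ?] ?] ?].
have := (TC true true true u v w, TC true true true v w u,
  TC true true true u w v, TC true true true w v u,
  TC false false false u v w, TC false false false v w u,
  TC false false false u w v, TC false false false w v u).
case=> [[[[[[[? ?] ?] ?] ?] ?] ?] ?].
lra.
Qed.

Lemma tr_LL u v : \tr (L u * L v) = 0.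
Proof.
apply: (perfect_functional (phi := fun u => \tr (L u * L v))) => [|{}u w].
  by move=> a x y; apply: tr_lin.
by rewrite trC [RHS]trC; apply: tr_LLcomm.
Qed.

Local Notation letter := (bool * V)%type.
Local Notation tw s := (\tr (word (mulmat pr X) s)).

Let word_cons (a : letter) s : word (mulmat pr X) (a :: s) = mulmat pr X a * word (mulmat pr X) s.
Proof. by rewrite /word big_cons. Qed.

Let word_rot (s1 s2 : seq letter) : tw (s1 ++ s2) = tw (s2 ++ s1).
Proof. by rewrite /word !big_cat /= trC. Qed.

(** Once shorter words are traceless, [mulmat_comm], [mulmatR] and [mulmatL], applied to the first
    two letters or to the second and third, become the hypotheses of [triple_word]. *)
Lemma tr_word_triple (W : seq letter) a b c u v w :
  (forall s, (0 < size s < (size W).+3)%N -> tw s = 0) ->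
  tw [:: (a, u), (b, v), (c, w) & W] =
  triple_coef R a b c * tw [:: (true, u), (true, v), (true, w) & W].
Proof.
move=> IH; pose t a b c u v w := tw [:: (a, u), (b, v), (c, w) & W].
pose Y := word (mulmat pr X) W.
have low d e : \tr (mulmat pr X d * (mulmat pr X e * Y)) = 0.
  by have := IH [:: d, e & W]; rewrite !word_cons; apply=> /=.
apply: (@triple_word _ _ t) => {}c {}u {}v {}w; rewrite /t !word_cons -/Y.
- have := congr1 (fun Z => \tr (Z * (mulmat pr X (c, w) * Y))) (mulmat_comm u v).
  by rewrite /= !mulrBl !linearB /= !low -!mulrA; lra.
- have := congr1 (fun Z => \tr (mulmat pr X (c, u) * (Z * Y))) (mulmat_comm v w).
  by rewrite /= !mulrBl !mulrBr !linearB /= !low -!mulrA; lra.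
- have := congr1 (fun Z => \tr (Z * (mulmat pr X (c, w) * Y))) (mulmatR v u).
  by rewrite /= !(mulrBl, mulrDl) !(linearB, linearD) /= !low -!mulrA; lra.
- have := congr1 (fun Z => \tr (mulmat pr X (c, u) * (Z * Y))) (mulmatR w v).
  by rewrite /= !(mulrBl, mulrDl, mulrBr, mulrDr) !(linearB, linearD) /= !low -!mulrA; lra.
- have := congr1 (fun Z => \tr (Z * (mulmat pr X (c, w) * Y))) (mulmatL v u).
  by rewrite /= !(mulrBl, mulrDl) !(linearB, linearD) /= !low -!mulrA; lra.
- have := congr1 (fun Z => \tr (mulmat pr X (c, u) * (Z * Y))) (mulmatL w v).
  by rewrite /= !(mulrBl, mulrDl, mulrBr, mulrDr) !(linearB, linearD) /= !low -!mulrA; lra.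
Qed.

(* Cyclicity of the trace identifies the words L R L ... and L L R ..., *)
(* whose coefficients -1/3 and -2/3 differ.                             *)
Lemma tr_wordL u v w us :
  (forall s, (0 < size s < (size us).+3)%N -> tw s = 0) ->
  tw (map (pair true) [:: u, v, w & us]) = 0.
Proof.
move=> IH; set A := tw _.
have e1 : tw ((false, u) :: map (pair true) [:: v, w & us]) = - (2 / 3) * A.
  by rewrite tr_word_triple ?size_map.
have [d [vs [dE szE]]] : exists d vs, w :: us = rcons vs d /\ size vs = size us.
  case/lastP: us @A {IH e1} => [|us d] A; first by exists w, [::].
  by exists d, (w :: us); rewrite rcons_cons /= size_rcons.
have e2 : tw ((false, u) :: map (pair true) [:: v, w & us]) = - (1 / 3) * A.
  have rotE b : tw ((b, u) :: map (pair true) [:: v, w & us]) =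
      tw [:: (true, d), (b, u), (true, v) & map (pair true) vs].
    by rewrite [map _ _]/= -[_ :: map _ us]/(map _ (w :: us)) dE map_rcons -cats1 -!cat_cons word_rot.
  by rewrite rotE tr_word_triple ?size_map ?szE // /A [map _ _]/= rotE.
by move: e1; rewrite e2; lra.
Qed.

(** Induction on the length and then on the number of R letters. A rotation brings an R letter to
    the front, and [tr_word_triple] replaces the first three letters by L's; [tr_wordL] settles the
    words without R. *)
Lemma tr_word_eq0 s : (0 < size s)%N -> tw s = 0.
Proof.
move: {2}(size s) (erefl (size s)) => k; elim/ltn_ind: k s => k IHk s szs s0.
have {IHk} IH s' : (0 < size s' < k)%N -> tw s' = 0.
  by case/andP => s'0 sk; apply: IHk sk _ (erefl _) s'0.
case: k szs s0 IH => [|[|[|k]]] szs s0 IH; first by rewrite szs in s0.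
- case: s szs {s0} => [|[[] u] [|]] // _; rewrite word_cons /word big_nil mulr1.
    exact: tr_L.
  exact: tr_S.
- case: s szs {s0} => [|[a u] [|[b v] [|]]] // _; rewrite !word_cons /word big_nil mulr1.
  case: a b => -[]; rewrite ?tr_LL ?tr_SS ?tr_LS ?tr_LL ?mulr0 //.
  by rewrite trC tr_LS tr_LL mulr0.
move: {2}(count (fun a => ~~ a.1) s) (erefl (count (fun a => ~~ a.1) s)) => m.
elim/ltn_ind: m s szs {s0} => m IHm s szs sm.
have [/hasP [[a u] + /= aN]|sL] := boolP (has (fun a => ~~ a.1) s); last first.
  have -> : s = map (pair true) (map snd s).
    rewrite -map_comp map_id_in // => -[a u] /(hasPn sL) /=.
    by rewrite negbK => ->.
  case: s szs {sm sL} => [|[a u] [|[b v] [|[c w] s]]] // [sk].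
  by apply: tr_wordL; rewrite size_map sk.
case: a aN => // _ /path.splitPr us; case: us sm szs => s1 s2 sm szs.
rewrite word_rot cat_cons; have szW : size (s2 ++ s1) = k.+2.
  by move: szs; rewrite !size_cat /= addnS addnC => -[].
move: sm; rewrite count_cat /= add1n addnS addnC -count_cat.
case: (s2 ++ s1) szW => [|[b v] [|[c w] W]] // [szW] sm.
rewrite tr_word_triple ?szW // (IHm _ _ _ _ (erefl _)) ?mulr0 //=; last by rewrite szW.
by rewrite -sm /= !add0n ltnS addnA leq_addl.
Qed.

(** Products of n+1 left multiplications vanish. But by perfectness a vector y orthogonal to all
    (k+1)-fold products is orthogonal to all k-fold ones; descending to k = 0, every y is zero. *)
Lemma perfect_absurd : False.
Proof.
have word0 us x : size us = n.+1 -> foldr pr x us = 0.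
  move=> sus; pose W := map (pair true) us.
  have : word (mulmat pr X) W = 0.
    by apply: (traceless_word0 tr_word_eq0); rewrite size_map.
  have -> : word (mulmat pr X) W = mxOf X (fun x => foldr pr x us).
    rewrite /W; elim: {sus W} us => [|u us IHus] /=.
      rewrite /word big_nil; apply/matrixP => i j; rewrite !mxE.
      by rewrite (coord_free _ _ (basis_free basX)) eq_sym.
    by rewrite word_cons IHus -[LHS]/(mxOf _ _ *m _) -(mxOf_comp basX) //; apply: (mulop_linear fp).
  move=> W0; have fl : linear (foldr pr ^~ us).
    by move=> a y z; elim: {sus W W0} us => //= u us ->; rewrite !(prE fp).
  rewrite (linear_sum_coord basX fl) big1 // => i _.
  rewrite [foldr _ _ _](coord_basis basX (memvf _)) big1 ?scaler0 // => j _.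
  by have := congr1 (fun M : 'M_n.+1 => M j i) W0; rewrite !mxE => ->; rewrite scale0r.
have all0 (y : V) : y = 0.
  suff H0 : forall k, (forall us x, size us = k -> om (foldr pr x us) y = 0) -> y = 0.
    by apply: (H0 n.+1) => us x /word0 ->; rewrite (om0l fp).
  elim=> [|k IHk] H.
    by apply: (fp_om_nondeg fp) => w; rewrite (fp_om_skew fp) (H [::] w) ?oppr0.
  apply: IHk => us x szus; apply: (perfect_functional (phi := fun x => om (foldr pr x us) y)).
    move=> a v w; rewrite -(omZl fp) -(omDl fp); congr (om _ y).
    by elim: {szus} us => //= u us ->; rewrite !(prE fp).
  move=> v w; have E v' w' : om (foldr pr (v' ∘ w') us) y = 0.
    by have := H (rcons us v') w'; rewrite foldr_rcons size_rcons szus; apply.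
  by rewrite !E.
have := basis_free basX; case/tupleP: X => x s.
by rewrite free_cons (all0 x) mem0v.
Qed.
End PerfectTraces.

(** * Reduction by a central element *)

Section Center.
Variables (R : realFieldType) (V : vectType R).
Variables (om : V -> V -> R) (pr : V -> V -> V).
Hypothesis fp : flat_product om pr.
Local Notation "u ∘ v" := (pr u v) (at level 40, left associativity).

Lemma exists_central : (0 < \dim {:V})%N -> exists2 z, z != 0 & central pr z.
Proof.
move=> dimV; apply: contrapT => nZ.
have perfect z : (forall u w, om (bracket pr u w) z = 0) -> z = 0.
  move=> zP; apply/eqP; apply: contraPT isT => z0 _; apply: nZ.
  exact: (not_perfect_central fp z0).
have := vbasisP (@fullv _ V); move: (vbasis _).
case: (\dim _) dimV => // n _ X bX.
exact: (perfect_absurd fp bX perfect).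
Qed.

Lemma exists_dual z : z != 0 -> exists f, om z f = 1.
Proof.
move=> z0; have [w /eqP zw] : exists w, om z w <> 0.
  apply/existsNP => zw; move/eqP: z0; apply; exact: (fp_om_nondeg fp).
by exists ((om z w)^-1 *: w); rewrite (omZr fp) mulVf.
Qed.

Section Reduction.
Variables e f : V.
Hypothesis eZ : central pr e.
Hypothesis ef : om e f = 1.

Let om_lin w : linear (om^~ w : V -> R^o).
Proof. by move=> a u v; rewrite (fp_om_linl fp). Qed.

Definition om_fun (w : V) : 'Hom(V, R^o) := 
  linfun (HB.pack_for {linear V -> R^o} (om^~ w : V -> R^o)
    (GRing.isLinear.Build _ _ _ _ _ (om_lin w))).

(** The orthogonal of the plane spanned by e and f, a concrete copy of the quotient e^perp / e;
    [redproj] is the projection onto it along that plane. *)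
Definition redspace : {vspace V} := (lker (om_fun e) :&: lker (om_fun f))%VS.

Lemma redspaceP x : reflect (om x e = 0 /\ om x f = 0) (x \in redspace).
Proof.
rewrite memv_cap !memv_ker /om_fun !lfunE /=.
by apply: (iffP andP) => -[/eqP ? /eqP].
Qed.

Definition redproj x := x + om x e *: f - om x f *: e.

Lemma redproj_in x : redproj x \in redspace.
Proof.
have fe : om f e = -1 by rewrite (fp_om_skew fp) ef.
apply/redspaceP; rewrite /redproj !(omE fp) fe ef !(omuu fp).
by split; ring.
Qed.

Lemma om_redproj x y : y \in redspace -> om (redproj x) y = om x y.
Proof.
case/redspaceP => ye yf; rewrite /redproj !(omE fp).
by rewrite (fp_om_skew fp f) (fp_om_skew fp e) ye yf; ring.
Qed.

Lemma redproj_id x : x \in redspace -> redproj x = x.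
Proof. by case/redspaceP => xe xf; rewrite /redproj xe xf !scale0r addr0 subr0. Qed.

Lemma central_om x y : om (x ∘ y) e = 0.
Proof. by rewrite (fp_sym fp) eZ (om0l fp). Qed.

Lemma pr_redproj_l x y z : om x e = 0 -> om ((redproj x) ∘ y) z = om (x ∘ y) z.
Proof.
by move=> xe; rewrite /redproj xe scale0r addr0 !(prE fp) (central_l fp y eZ) scaler0 subr0.
Qed.

Definition red_om (x y : subvs_of redspace) := om (vsval x) (vsval y).
Definition red_pr (x y : subvs_of redspace) : subvs_of redspace :=
  vsproj redspace (redproj (vsval x ∘ vsval y)).

Lemma red_prE x y : vsval (red_pr x y) = redproj (vsval x ∘ vsval y).
Proof. by rewrite /red_pr vsprojK ?redproj_in. Qed.

Lemma red_prP x y z : red_om (red_pr x y) z = om (vsval x ∘ vsval y) (vsval z).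
Proof. by rewrite /red_om red_prE om_redproj ?subvsP. Qed.

(** Products lie in e^perp, so projecting them changes them only by multiples of e, which are
    central and orthogonal to [redspace]. *)
Lemma red_flat : flat_product red_om red_pr.
Proof.
have nd x : (forall y, red_om x y = 0) -> x = 0.
  move=> x0; apply: val_inj; apply: (fp_om_nondeg fp) => w; rewrite /=.
  have [xe xf] := redspaceP _ (subvsP x).
  have := x0 (vsproj redspace (redproj w)).
  rewrite /red_om vsprojK ?redproj_in // /redproj !(omE fp) xe xf.
  by rewrite !mulr0 subr0 addr0.
have inj x y : (forall z, red_om x z = red_om y z) -> x = y.
  move=> xy; apply/eqP; rewrite -subr_eq0; apply/eqP/nd => z.
  by rewrite /red_om linearB /= !(omE fp); apply/eqP; rewrite subr_eq0; apply/eqP/xy.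
split=> //.
- by move=> w a u v; rewrite /red_om linearP /= (fp_om_linl fp).
- by move=> u v; rewrite /red_om (fp_om_skew fp).
- move=> w a u v; apply: inj => z.
  rewrite {2}/red_om linearP /= (fp_om_linl fp) -!/(red_om _ _) !red_prP.
  by rewrite linearP /= (fp_linl fp) (fp_om_linl fp).
- move=> w a u v; apply: inj => z.
  rewrite {2}/red_om linearP /= (fp_om_linl fp) -!/(red_om _ _) !red_prP.
  by rewrite linearP /= (fp_linr fp) (fp_om_linl fp).
- by move=> u v w; rewrite !red_prP (fp_sym fp).
- by move=> u v w; rewrite !red_prP (fp_cyc fp).
move=> u v w; apply: inj => z; rewrite /red_om !linearB /= !(omE fp) -!/(red_om _ _).
have lsa := congr1 (om^~ (vsval z)) (fp_lsa fp (vsval u) (vsval v) (vsval w)).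
have E1 x y : om (x ∘ redproj y) (vsval z) = om (x ∘ y) (vsval z) + om y e * om (x ∘ f) (vsval z).
  by rewrite /redproj !(prE fp) eZ scaler0 subr0 !(omE fp).
move: lsa; rewrite !red_prP !red_prE !E1 !central_om !pr_redproj_l ?central_om //.
by rewrite !(omE fp); lra.
Qed.

Lemma redspace_dim n : \dim {:V} = n.+2 -> \dim {: subvs_of redspace} = n.
Proof.
move=> dimV; have fe : om f e = -1 by rewrite (fp_om_skew fp) ef.
have -> : \dim {: subvs_of redspace} = \dim redspace by rewrite !dimvf /dim /=.
have mem_ef x : x \in <<[:: e; f]>>%VS -> exists a b, x = a *: e + b *: f.
  by rewrite span_cons span_seq1 => /memv_addP [_ /vlineP [a ->] [_ /vlineP [b ->] ->]]; exists a, b.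
have coef a b : om (a *: e + b *: f) f = a /\ om (a *: e + b *: f) e = - b.
  by rewrite !(omE fp) !(omuu fp) fe ef; split; ring.
have free_ef : free [:: e; f].
  rewrite free_cons seq1_free span_seq1; apply/andP; split.
    apply/vlineP => -[k ek]; have := ef; rewrite ek (omZl fp) (omuu fp) mulr0.
    by move/esym/eqP; rewrite oner_eq0.
  by apply/eqP => f0; move: ef; rewrite f0 (om0r fp) => /esym/eqP; rewrite oner_eq0.
have disj : (redspace :&: <<[:: e; f]>>)%VS = 0%VS.
  apply/eqP; rewrite -subv0; apply/subvP => x /memv_capP [/redspaceP [xe xf] /mem_ef].
  case=> [a [b xE]]; have [xfE xeE] := coef a b.
  have a0 : a = 0 by rewrite -xfE -xE.
  have b0 : b = 0 by rewrite -[b]opprK -xeE -xE xe oppr0.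
  by rewrite xE a0 b0 !scale0r addr0 mem0v.
have full : (redspace + <<[:: e; f]>>)%VS = fullv.
  apply/eqP; rewrite eqEsubv subvf; apply/subvP => x _.
  have -> : x = redproj x + (om x f *: e - om x e *: f).
    by apply: (om_inj fp) => w; rewrite /redproj !(omE fp); ring.
  rewrite memv_add ?redproj_in // memvB // memvZ // memv_span // !inE eqxx ?orbT //.
have := dimv_disjoint_sum disj; rewrite full dimV (eqP free_ef) /= => /eqP.
by rewrite addn2 !eqSS => /eqP.
Qed.

End Reduction.
End Center.

(** * Isotropic families, and triviality in dimension two *)

Section Isotropic.
Variables (R : realFieldType) (V : vectType R).
Variables (om : V -> V -> R) (pr : V -> V -> V).
Hypothesis fp : flat_product om pr.
Local Notation "u ∘ v" := (pr u v) (at level 40, left associativity).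

(** In coordinates A G A^T = 0 with G invertible, which bounds twice the rank of A by the
    dimension. *)
Lemma isotropic_size (s : seq V) : free s ->
  {in s &, forall x y, om x y = 0} -> ((size s).*2 <= \dim {:V})%N.
Proof.
move=> fs iso; case: s fs iso => [|x0 s'] //; set s := x0 :: s' => fs iso.
have dimV : (0 < \dim {:V})%N.
  by rewrite (leq_trans _ (dimvS (subvf <<s>>))) // (eqP fs).
have := vbasisP (@fullv _ V); move: (vbasis _).
case: (\dim _) dimV => // n _ X bX.
pose A : 'M[R]_(size s, n.+1) := \matrix_(i, j) coord X j s`_i.
have om_s v : om v = fun w => \sum_j coord X j v * om X`_j w.
  apply/funext => w; rewrite {1}[v](coord_basis bX (memvf _)).
  rewrite (big_morph (om^~ w) (fun u v => omDl fp u v w) (om0l fp w)).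
  by apply: eq_bigr => i _; rewrite (omZl fp).
have AG : A *m (gram om X *m A^T) = 0.
  apply/matrixP => i k; rewrite !mxE -[RHS](iso s`_i s`_k) ?mem_nth //.
  rewrite om_s; apply: eq_bigr => j _; rewrite !mxE; congr (_ * _).
  rewrite (fp_om_skew fp) om_s -sumrN; apply: eq_bigr => l _.
  by rewrite !mxE (fp_om_skew fp) mulNr mulrC.
have rA : \rank A = size s.
  apply/eqP/inj_row_free => v vA.
  have : \sum_(i < size s) v 0 i *: s`_i = 0.
    transitivity (\sum_j (v *m A) 0 j *: X`_j).
      under [RHS]eq_bigr => j _ do rewrite mxE scaler_suml.
      rewrite exchange_big; apply: eq_bigr => i _ /=.
      rewrite {1}[s`_i](coord_basis bX (memvf _)) scaler_sumr.
      by apply: eq_bigr => j _; rewrite mxE scalerA.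
    by rewrite vA big1 // => j _; rewrite mxE scale0r.
  have /freeP fsP : free (in_tuple s) := fs.
  by move/(fsP (fun i => v 0 i)) => v0; apply/rowP => i; rewrite v0 mxE.
have Gfull : row_full (gram om X) by rewrite row_full_unit (gram_unit fp bX).
by have := mulmx0_rank_max AG; rewrite (eqmxMfull _ Gfull) mxrank_tr rA addnn.
Qed.

Lemma orth_span (s : seq V) v : free s -> size s = \dim {:V} ->
  {in s, forall x, om v x = 0} -> v = 0.
Proof.
move=> fs szs vs; have sT : <<s>>%VS = fullv.
  by apply/eqP; rewrite eqEdim subvf (eqP fs) szs /=.
apply: (fp_om_nondeg fp) => w; have : w \in <<s>>%VS by rewrite sT memvf.
rewrite -[s in <<s>>%VS]/(tval (in_tuple s)) => /coord_span ->.
rewrite (big_morph (om v) (fun x y => omDr fp x y v) (om0r fp v)) big1 // => i _.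
by rewrite (omZr fp) vs ?mulr0 ?mem_nth.
Qed.

Lemma free_cons2 (x y : V) : x != 0 -> y \notin <[x]>%VS -> free [:: y; x].
Proof. by move=> x0 yx; rewrite free_cons span_seq1 yx seq1_free x0. Qed.

(** Only f.f could be nonzero; it lies in e^perp, the line of e, and the cyclic identity at f, f, f
    kills its coefficient. *)
Lemma flat_dim2_trivial u v : \dim {:V} = 2 -> u ∘ v = 0.
Proof.
move=> dimV; have [|e e0 eZ] := exists_central fp; first by rewrite dimV.
have [f ef] := exists_dual fp e0.
have mem_e x : om x e = 0 -> x \in <[e]>%VS.
  move=> xe; apply: contraT => /(free_cons2 e0) fr.
  have := isotropic_size fr; rewrite dimV /=; apply=> a b.
  rewrite !inE => /orP [] /eqP-> /orP [] /eqP ->; rewrite ?(omuu fp) ?xe //.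
  by rewrite (fp_om_skew fp) xe oppr0.
have dec x : exists a b, x = a *: e + b *: f.
  have /mem_e /vlineP [a xE] : om (x + om x e *: f) e = 0.
    by rewrite !(omE fp) (fp_om_skew fp f) ef; ring.
  by exists a, (- om x e); rewrite -xE scaleNr addrK.
have ff : f ∘ f = 0.
  have /mem_e /vlineP [a ffE] := central_om fp eZ f f.
  have := fp_cyc fp f f f; rewrite ffE !(omZl fp) ef => a3.
  have -> : a = 0 by lra.
  by rewrite scale0r.
have [a [b ->]] := dec u; have [c [d ->]] := dec v.
by rewrite !(prE fp) !(central_l fp _ eZ) !eZ ff !(scaler0, addr0).
Qed.

End Isotropic.

(* The tables number the basis from 1, sequences are numbered from 0. *)
Definition structure_table (R : fieldType) (V : vectType R) (br : V -> V -> V)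
    (m : flat6_name) (s : seq V) :=
  [/\ free s, size s = 6 & forall i j, (i < j < 6)%N ->
    br s`_i s`_j = \sum_(t <- flat6_table m | t.1 == (i.+1, j.+1)) s`_(t.2.-1)].

Lemma free6P (R : fieldType) (V : vectType R) (x1 x2 x3 x4 x5 x6 : V) :
  (forall k1 k2 k3 k4 k5 k6,
    k1 *: x1 + (k2 *: x2 + (k3 *: x3 + (k4 *: x4 + (k5 *: x5 + k6 *: x6)))) = 0 ->
    [/\ k1 = 0, k2 = 0, k3 = 0 & [/\ k4 = 0, k5 = 0 & k6 = 0]]) ->
  free [:: x1; x2; x3; x4; x5; x6].
Proof.
move=> x0; apply/(@freeP _ _ 6 [tuple x1; x2; x3; x4; x5; x6]) => k.
rewrite !big_ord_recl big_ord0 /= !addr0 => /x0 [k0 k1 k2 [k3 k4 k5]].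
case=> -[|[|[|[|[|[|i]]]]]] //= i6; [apply: etrans k0 | apply: etrans k1
  | apply: etrans k2 | apply: etrans k3 | apply: etrans k4 | apply: etrans k5];
  by congr (k _); apply: val_inj.
Qed.

(** * Lifting a reduction with zero product *)

Section AbelianReduction.
Variables (R : realFieldType) (V : vectType R).
Variables (om : V -> V -> R) (pr : V -> V -> V).
Hypothesis fp : flat_product om pr.
Local Notation "u ∘ v" := (pr u v) (at level 40, left associativity).
Variables e f : V.
Hypothesis eZ : central pr e.
Hypothesis ef : om e f = 1.
Local Notation H x := (om x e = 0).

Let fe : om f e = -1. Proof. by rewrite (fp_om_skew fp) ef. Qed.
Let prH x y : H (x ∘ y). Proof. exact: (central_om fp eZ). Qed.
Let omeH x y : om e (x ∘ y) = 0.
Proof. by rewrite (fp_om_skew fp) prH oppr0. Qed.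
Let hH x : H (x + om x e *: f).
Proof. by rewrite !(omE fp) fe; ring. Qed.

Lemma orth_hyperplane a : H a -> (forall z, H z -> om a z = 0) -> a = om a f *: e.
Proof.
move=> aH a0; apply: (om_inj fp) => w; have := a0 _ (hH w).
rewrite !(omE fp) (fp_om_skew fp e w); lra.
Qed.

Lemma om_xff x : om (x ∘ f) f = - 2 * om (f ∘ f) x.
Proof. by have := fp_cyc fp x f f; rewrite (fp_sym fp f x f); lra. Qed.

(** Flatness for f, z, f is paired with f, and [om_xff] turns every term into a value of omega(f.f,
    -). *)
Lemma pr_cube : f ∘ (f ∘ f) = 0.
Proof.
apply: (fp_om_nondeg fp) => z; have := congr1 (om^~ f) (fp_lsa fp f z f).
rewrite !(omE fp) !om_xff (fp_sym fp f _ f) (fp_sym fp z _ f).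
by rewrite (fp_om_skew fp (z ∘ f)) (om_adjL fp f (f ∘ f)); lra.
Qed.

Section Abelian.
Hypothesis ab : forall x y z, H x -> H y -> H z -> om (x ∘ y) z = 0.

Let abE x y : H x -> H y -> x ∘ y = om (x ∘ y) f *: e.
Proof. by move=> xH yH; apply: orth_hyperplane => // z; apply: ab. Qed.

(* On e^perp / e let xi be right multiplication by f. Then [abelian_RR],       *)
(* [abelian_LRf] and [abelian_RRf] state that xi^* xi, xi (xi^* - xi) and xi^2 *)
(* vanish.                                                                     *)
Lemma abelian_RR x y : H x -> H y -> om (x ∘ f) (y ∘ f) = 0.
Proof.
move=> xH yH; have := congr1 (om^~ f) (fp_lsa fp x y f).
rewrite (abE xH yH) (abE yH xH) !(prE fp) !(central_l fp _ eZ) !scaler0 !subr0.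
rewrite (fp_sym fp x (y ∘ f)) (fp_sym fp y (x ∘ f)) (fp_om_skew fp (y ∘ f)); lra.
Qed.

Lemma abelian_LRf x z : H x -> H z -> om ((f ∘ x) ∘ f) z = 0.
Proof.
move=> xH zH; have := congr1 (om^~ z) (fp_lsa fp f x f); have := abelian_RR xH zH.
have := ab xH (prH f f) zH; rewrite !(omE fp) (om_adjL fp f (x ∘ f)).
by rewrite (om_adjR fp (f ∘ x) f) (om_adjR fp (x ∘ f) f) !(omE fp); lra.
Qed.

(** The first and last identities together make omega(xi^2 x, z) skew in x and z. *)
Lemma abelian_skew x z : H x -> H z ->
  [/\ om ((x ∘ f) ∘ f) z = om (x ∘ f) (f ∘ z),
     om (f ∘ x) (f ∘ z) = - om (x ∘ f) (f ∘ z)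
   & om (x ∘ f) (f ∘ z) = - om (z ∘ f) (f ∘ x)].
Proof.
move=> xH zH; have rr := abelian_RR xH zH.
have lr1 := abelian_LRf xH zH; have lr2 := abelian_LRf zH xH.
move: lr1 lr2; rewrite (om_adjR fp (x ∘ f) f) (om_adjR fp (f ∘ x) f) (om_adjR fp (f ∘ z) f) !(omE fp).
have := fp_om_skew fp (f ∘ x) (z ∘ f); have := fp_om_skew fp (f ∘ z) (x ∘ f).
have := fp_om_skew fp (f ∘ z) (f ∘ x).
by split; lra.
Qed.

Hypothesis dimV : (\dim {:V} < 8)%N.

Let notin_span2 (x y z : V) : x != 0 -> y \notin <[x]>%VS -> z \notin <<[:: y; x]>>%VS ->
  free [:: z; y; x].
Proof. by move=> x0 yx zyx; rewrite free_cons zyx free_cons2. Qed.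

Let e0 : e != 0.
Proof.
by apply/eqP => e0; move: ef; rewrite e0 (om0l fp) => /esym/eqP; rewrite oner_eq0.
Qed.

(* The form omega(xi^2 x, z) is skew, so xi^*^2 = xi^2. If c = xi^2 x did not     *)
(* vanish, then xi x and c would span a Lagrangian of the 4-dimensional quotient, *)
(* hence contain d = xi^* x, being orthogonal to both; but then xi^* d = 0.       *)
Lemma abelian_RRf x z : H x -> H z -> om ((x ∘ f) ∘ f) z = 0.
Proof.
move=> xH zH; apply/eqP; apply: contraT => cz.
(* On e^perp / e these are xi x, xi^2 x and the adjoint of xi applied to x. *)
pose a := x ∘ f; pose c := a ∘ f; pose d := f ∘ x + a.
have aH : H a by apply: prH.
have cH : H c by apply: prH.
have dH : H d by rewrite !(omE fp) !prH addr0.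
have ac : om a c = 0 by apply: abelian_RR.
have [RRfE LLE RLE] := abelian_skew xH zH.
have dza : om d a = 0.
  rewrite /d (omDl fp) (omuu fp) addr0.
  have := abelian_LRf xH xH; rewrite (om_adjR fp (f ∘ x) f) !(omE fp) (omuu fp).
  by rewrite add0r.
have dzc : om d c = 0.
  rewrite /d (omDl fp) ac addr0; have := abelian_LRf xH aH.
  rewrite (om_adjR fp (f ∘ x) f) (omDr fp); have [ca LL _] := abelian_skew xH aH.
  rewrite LL -ca -[(x ∘ f) ∘ f]/c (fp_om_skew fp c) ac.
  by rewrite !oppr0 add0r.
have cf0 y : H y -> om (c ∘ f) y = 0.
  move=> yH; have fac : f ∘ a + c = om (f ∘ a + c) f *: e.
    apply: orth_hyperplane => [|w wH]; first by rewrite !(omE fp) !prH addr0.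
    by rewrite (fp_om_skew fp) -(om_adjR fp) abelian_RR ?oppr0.
  have := abelian_LRf aH yH; rewrite -[f ∘ a](addrK c) fac !(prE fp).
  by rewrite (central_l fp _ eZ) scaler0 sub0r (omE fp) => /eqP; rewrite oppr_eq0 => /eqP.
have cne : c \notin <[e]>%VS.
  apply: contra cz => /vlineP [k cE].
  by rewrite -/a -/c cE (omE fp) (fp_om_skew fp e) zH oppr0 mulr0.
have ace : a \notin <<[:: c; e]>>%VS.
  apply: contra cz; rewrite span_cons span_seq1.
  case/memv_addP => _ /vlineP [k ->] [_ /vlineP [l ->] aE].
  rewrite -/a -/c {1}/c aE !(prE fp) (central_l fp _ eZ) scaler0 addr0 (omE fp) cf0 //.
  by rewrite mulr0.
have : d \in <<[:: a; c; e]>>%VS.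
  apply: contraT => dace.
  have fr : free [:: d; a; c; e] by rewrite free_cons dace notin_span2.
  have := isotropic_size fp fr; rewrite /= => le8.
  move: dimV; rewrite ltnNge le8 // => u v.
  have ed : om e d = 0 by rewrite (fp_om_skew fp) dH oppr0.
  have ea : om e a = 0 by rewrite (fp_om_skew fp) aH oppr0.
  have ec : om e c = 0 by rewrite (fp_om_skew fp) cH oppr0.
  have ad : om a d = 0 by rewrite (fp_om_skew fp) dza oppr0.
  have cd : om c d = 0 by rewrite (fp_om_skew fp) dzc oppr0.
  have ca : om c a = 0 by rewrite (fp_om_skew fp) ac oppr0.
  rewrite !inE => /or4P [] /eqP-> /or4P [] /eqP-> //; exact: (omuu fp).
rewrite !span_cons span_nil addv0.
case/memv_addP => _ /vlineP [r ->] [_ /memv_addP [_ /vlineP [t ->] [_ /vlineP [k ->] ->]] dE].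
(* The left side vanishes when d is expanded in a, c, e, since all three are orthogonal to z.f. *)
have : om d (z ∘ f) = om c z.
  rewrite /d (omE fp) abelian_RR // addr0 (fp_om_skew fp) RRfE RLE //.
rewrite dE !(omE fp) omeH !abelian_RR // !mulr0 !addr0 => /esym/eqP.
by rewrite -/a -/c in cz *; rewrite (negPf cz).
Qed.

Lemma abelian_LR x z : H x -> H z -> om (x ∘ f) (f ∘ z) = 0.
Proof. by move=> xH zH; have [<- _ _] := abelian_skew xH zH; apply: abelian_RRf. Qed.

Lemma abelian_LL x z : H x -> H z -> om (f ∘ x) (f ∘ z) = 0.
Proof. by move=> xH zH; have [_ -> _] := abelian_skew xH zH; rewrite abelian_LR ?oppr0. Qed.

(** Every vector is h + k f with h in e^perp. Pairings that involve f.f reduce by adjunction to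
    f.(f.f) = 0 and to (f.f).f; the other ones vanish by the relations on xi. *)
Lemma abelian_products_isotropic : (forall z, H z -> om ((f ∘ f) ∘ f) z = 0) ->
  forall u v w x, om (u ∘ v) (w ∘ x) = 0.
Proof.
move=> c0.
have dec u : exists2 h, H h & exists k, u = h + k *: f.
  by exists (u + om u e *: f) => //; exists (- om u e); rewrite scaleNr addrK.
have bh h : H h -> om (f ∘ f) (h ∘ f) = 0.
  move=> hh; rewrite (fp_om_skew fp) (om_adjR fp) (omE fp).
  by rewrite pr_cube (om0r fp) (fp_om_skew fp h) c0 // oppr0 addr0 oppr0.
have bl h : H h -> om (f ∘ f) (f ∘ h) = 0.
  move=> hh; rewrite (fp_om_skew fp) (om_adjL fp).
  by rewrite pr_cube (om0r fp) !oppr0.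
have hb h : H h -> om (h ∘ f) (f ∘ f) = 0.
  by move=> hh; rewrite (fp_om_skew fp) bh ?oppr0.
have lb h : H h -> om (f ∘ h) (f ∘ f) = 0.
  by move=> hh; rewrite (fp_om_skew fp) bl ?oppr0.
have RLs x z : H x -> H z -> om (f ∘ z) (x ∘ f) = 0.
  by move=> xH zH; rewrite (fp_om_skew fp) abelian_LR ?oppr0.
move=> u v w x; have [h hh [k ->]] := dec u; have [h1 h1h [k1 ->]] := dec v.
have [h2 h2h [k2 ->]] := dec w; have [h3 h3h [k3 ->]] := dec x.
rewrite !(prE fp) (abE hh h1h) (abE h2h h3h) !(omE fp) !omeH !prH (omuu fp).
rewrite (abelian_RR hh h2h) (abelian_LR hh h3h) (abelian_LL h1h h3h) (RLs _ _ h2h h1h).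
rewrite (bh _ h2h) (bl _ h3h) (hb _ hh) (lb _ h1h).
by rewrite (omuu fp) !mulr0 !addr0.
Qed.


Lemma abelian_bracketH x y : H x -> H y ->
  bracket pr x y = (om (x ∘ f) y - om (y ∘ f) x) *: e.
Proof.
move=> xH yH; rewrite /bracket (abE xH yH) (abE yH xH) -scalerBl.
by rewrite (fp_sym fp x) (fp_sym fp y).
Qed.

Lemma abelian_bracketf x : H x -> (forall z, H z -> om (f ∘ x) z = 0 /\ om (x ∘ f) z = 0) ->
  bracket pr f x = (3 * om (f ∘ f) x) *: e.
Proof.
move=> xH x0; rewrite /bracket.
rewrite (orth_hyperplane (prH f x) (fun z zH => proj1 (x0 z zH))).
rewrite (orth_hyperplane (prH x f) (fun z zH => proj2 (x0 z zH))).
by rewrite -scalerBl om_xff (fp_sym fp f); congr (_ *: _); ring.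
Qed.

(** The chain f, b = f.f, c = b.f, a vector Y of e^perp dual to c, the bracket [f, Y] and e form the
    basis, up to scalars. *)
Lemma abelian_G6_3 z : H z -> om ((f ∘ f) ∘ f) z <> 0 ->
  exists s, structure_table (bracket pr) G6_3 s.
Proof.
move=> zH /eqP cz; pose b := f ∘ f; pose c := b ∘ f.
have bH : H b by apply: prH.
have cH : H c by apply: prH.
have [Y YH cY] : exists2 Y, H Y & om c Y = 1.
  by exists ((om c z)^-1 *: z); rewrite ?(omZl fp) ?(omZr fp) ?zH ?mulr0 ?mulVf.
have [x4 x4E] : exists x4, x4 = bracket pr f Y by exists (bracket pr f Y).
have x4H : H x4 by rewrite x4E !(omE fp) !prH subr0.
have Y' : om Y c = -1 by rewrite (fp_om_skew fp) cY.
have fb : f ∘ b = 0 by apply: pr_cube.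
have bfY : om b (f ∘ Y) = 0 by rewrite (fp_om_skew fp) (om_adjL fp) fb (om0r fp); ring.
have bYf : om b (Y ∘ f) = 1.
  by rewrite (fp_om_skew fp) (om_adjR fp) fb add0r -/c Y' opprK.
have bx4 : om b x4 = -1 by rewrite x4E /bracket !(omE fp) bfY bYf sub0r.
have xx4 x : H x -> om x4 (f ∘ x) = 0 /\ om x4 (x ∘ f) = 0.
  move=> xH; rewrite x4E /bracket !(omE fp) abelian_LL // abelian_LR // abelian_RR //.
  by rewrite (fp_om_skew fp (f ∘ Y)) abelian_LR // oppr0 ?subr0 ?oppr0 ?addr0.
have xc x : H x -> om c (f ∘ x) = 0 /\ om c (x ∘ f) = 0.
  by move=> xH; rewrite abelian_LR // abelian_RR.
have orthP y : (forall x, H x -> om y (f ∘ x) = 0 /\ om y (x ∘ f) = 0) ->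
    forall x, H x -> om (f ∘ y) x = 0 /\ om (y ∘ f) x = 0.
  move=> y0 x xH; have [yl yr] := y0 x xH.
  by rewrite (om_adjL fp) (om_adjR fp) (omE fp) yl yr oppr0 addr0.
have c4 : om c x4 = 0.
  by rewrite x4E /bracket !(omE fp) abelian_LR // abelian_RR // oppr0 addr0.
have bc : om b c = 0.
  by have := om_adjR fp b f b; rewrite fb add0r -/c (fp_om_skew fp c); lra.
have cb : om c b = 0 by rewrite (fp_om_skew fp) bc oppr0.
have x4c : om x4 c = 0 by rewrite (fp_om_skew fp) c4 oppr0.
have x4b : om x4 b = 1 by rewrite (fp_om_skew fp) bx4 opprK.
have x4f := orthP _ xx4; have cf := orthP _ xc.
have fx4 : bracket pr f x4 = (- 3) *: e by rewrite abelian_bracketf // -/b bx4; congr (_ *: _); ring.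
have fc : bracket pr f c = 0 by rewrite abelian_bracketf // -/b bc mulr0 scale0r.
have bfb : bracket pr f b = - c by rewrite /bracket fb sub0r.
have bre x : bracket pr x e = 0 by rewrite /bracket eZ (central_l fp _ eZ) subr0.
have brZ x k y : bracket pr x (k *: y) = k *: bracket pr x y.
  by rewrite /bracket !(prE fp) scalerBr.
have brZl x k y : bracket pr (k *: x) y = k *: bracket pr x y.
  by rewrite /bracket !(prE fp) scalerBr.
have Yx4 : bracket pr Y x4 = 0.
  have [_ E1] := x4f Y YH; have [_ E2] := xx4 Y YH.
  by rewrite abelian_bracketH // E1 (fp_om_skew fp) E2 oppr0 addr0 scale0r.
have bx4' : bracket pr b x4 = 0.
  have [_ E1] := x4f b bH; have [_ E2] := xx4 b bH.
  by rewrite abelian_bracketH // E1 (fp_om_skew fp) E2 oppr0 addr0 scale0r.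
have brc x : H x -> bracket pr x c = 0.
  move=> xH; have [_ E1] := cf x xH; have [_ E2] := xc x xH.
  by rewrite abelian_bracketH // E1 (fp_om_skew fp) E2 oppr0 addr0 scale0r.
have Yb : bracket pr Y b = (- 2) *: e.
  rewrite abelian_bracketH // -/c cY (fp_om_skew fp) bYf; congr (_ *: _); ring.
(* The scalars absorb [f, b] = - c, [f, x4] = - 3 e and [Y, b] = - 2 e. *)
exists [:: f; Y; (3 / 2) *: b; x4; - (3 / 2) *: c; (- 3) *: e]; split=> //.
  apply: free6P => k1 k2 k3 k4 k5 k6 E; have Ew w := congr1 (om^~ w) E.
  have k10 : k1 = 0.
    have := Ew e; rewrite !(omE fp) fe YH bH x4H cH (omuu fp); lra.
  have k20 : k2 = 0.
    have := Ew c; rewrite !(omE fp) k10 Y' bc x4c (omuu fp) (fp_om_skew fp e) cH; lra.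
  have k30 : k3 = 0.
    have := Ew x4; rewrite !(omE fp) k10 k20 bx4 c4 (omuu fp) (fp_om_skew fp e) x4H; lra.
  have k40 : k4 = 0.
    have := Ew b; rewrite !(omE fp) k10 k20 x4b cb (omuu fp) (fp_om_skew fp e) bH; lra.
  have k50 : k5 = 0.
    have := Ew Y; rewrite !(omE fp) k10 k20 k30 k40 cY (omuu fp) (fp_om_skew fp e) YH; lra.
  have k60 : k6 = 0.
    have := Ew f; rewrite !(omE fp) k10 k20 k30 k40 k50 ef; lra.
  by [].
case=> [|[|[|[|[|[|i]]]]]] [|[|[|[|[|[|j]]]]]] /andP[] //= _ _.
all: rewrite ?big_cons ?big_nil /= ?addr0 ?brZ ?brZl ?bre ?fc ?brc //.
all: rewrite ?fx4 ?bfb ?Yx4 ?bx4' ?Yb ?scaler0 //.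
- by rewrite scalerN scaleNr.
- by rewrite scalerA; congr (_ *: _); lra.
Qed.

End Abelian.
End AbelianReduction.

(** * Dimensions four and six *)

Section Dim4.
Variables (R : realFieldType) (V : vectType R).
Variables (om : V -> V -> R) (pr : V -> V -> V).
Hypothesis fp : flat_product om pr.
Local Notation "u ∘ v" := (pr u v) (at level 40, left associativity).

Definition redelt e f (ef : om e f = 1) w : subvs_of (redspace fp e f) :=
  vsproj (redspace fp e f) (redproj om e f w).

Lemma redelt_val e f (ef : om e f = 1) w : vsval (redelt ef w) = redproj om e f w.
Proof. by rewrite /redelt vsprojK ?redproj_in. Qed.

Lemma red_pr_om e f (ef : om e f = 1) x y z : central pr e ->
  om x e = 0 -> om y e = 0 -> om z e = 0 ->
  red_om (red_pr (redelt ef x) (redelt ef y)) (redelt ef z) = om (x ∘ y) z.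
Proof.
move=> eZ xe ye ze.
have omr a b : om b e = 0 -> om a e = 0 -> om a (redproj om e f b) = om a b.
  by move=> be ae; rewrite /redproj be !(omE fp) ae; ring.
rewrite (red_prP (fp := fp) ef) !redelt_val omr ?(central_om fp eZ) //.
rewrite (pr_redproj_l fp f eZ) // (fp_sym fp) (omr _ _ ye) ?(central_om fp eZ) //.
by rewrite (fp_sym fp).
Qed.

(** The reduction has dimension 2, hence zero product. If (f.f).f were not orthogonal to e^perp,
    then e, f.f and (f.f).f would be three independent, mutually orthogonal vectors in dimension
    4. *)
Lemma dim4_products_isotropic : \dim {:V} = 4 ->
  forall u v w x, om (u ∘ v) (w ∘ x) = 0.
Proof.
move=> dimV; have [|e e0 eZ] := exists_central fp; first by rewrite dimV.
have [f ef] := exists_dual fp e0.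
have ab : forall x y z, om x e = 0 -> om y e = 0 -> om z e = 0 -> om (x ∘ y) z = 0.
  move=> x y z xe ye ze; rewrite -(red_pr_om ef eZ xe ye ze).
  rewrite (_ : red_pr _ _ = 0) ?(om0l (red_flat fp eZ ef)) //.
  by apply: (flat_dim2_trivial (red_flat fp eZ ef)); apply: (redspace_dim fp ef).
have dim8 : (\dim {:V} < 8)%N by rewrite dimV.
apply: (abelian_products_isotropic fp eZ ef ab dim8) => z ze.
apply/eqP; apply: contraT => cz; pose b := f ∘ f; pose c := b ∘ f.
have be : om b e = 0 by apply: (central_om fp eZ).
have ce : om c e = 0 by apply: (central_om fp eZ).
have bne : b \notin <[e]>%VS.
  apply: contra cz => /vlineP [k bE].
  by rewrite -/b bE !(prE fp) (central_l fp _ eZ) scaler0 (om0l fp).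
have cbe : c \notin <<[:: b; e]>>%VS.
  apply: contra (cz); rewrite span_cons span_seq1.
  case/memv_addP => _ /vlineP [k ->] [_ /vlineP [l ->] cE].
  have := abelian_RRf fp eZ ef ab dim8 be ze; rewrite -/c [in c ∘ f]cE !(prE fp).
  rewrite (central_l fp _ eZ) scaler0 addr0 (omE fp) -/b -/c => /eqP.
  rewrite mulf_eq0 [om c z == 0](negPf cz) orbF => /eqP k0.
  by move: cz; rewrite -/b -/c cE k0 scale0r add0r (omE fp) (fp_om_skew fp) ze oppr0 mulr0 eqxx.
have cb : om c b = 0.
  have := om_adjR fp b f b; rewrite (pr_cube fp) add0r -/c (fp_om_skew fp b c).
  by lra.
have fr : free [:: c; b; e].
  by rewrite free_cons cbe free_cons2.
have := isotropic_size fp fr; rewrite dimV => /= le.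
suff : false by []; apply: le => u v.
have eb : om e b = 0 by rewrite (fp_om_skew fp) be oppr0.
have ec : om e c = 0 by rewrite (fp_om_skew fp) ce oppr0.
have bc : om b c = 0 by rewrite (fp_om_skew fp) cb oppr0.
by rewrite !inE => /or3P [] /eqP-> /or3P [] /eqP-> //; exact: (omuu fp).
Qed.

(** Some square p.p is nonzero: otherwise omega(x.y, z) would be both symmetric and alternating in y
    and z. Then q is a vector dual to p.p, corrected twice. *)
Lemma dim4_normal_form x y z : \dim {:V} = 4 -> om (x ∘ y) z <> 0 ->
  exists p q, [/\ om (p ∘ p) q = 1, om (p ∘ q) q = 0, om p q = 0,
    central pr (p ∘ p) & central pr (p ∘ q)].
Proof.
move=> dimV xyz; have iso := dim4_products_isotropic dimV.
have cent u v : central pr (u ∘ v).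
  move=> w; apply: (fp_om_nondeg fp) => a.
  by rewrite (om_adjL fp) iso oppr0.
have ppp u : om (u ∘ u) u = 0 by have := fp_cyc fp u u u; lra.
have [p /eqP pp0] : exists p, p ∘ p <> 0.
  apply/existsNP => sq0; apply: xyz.
  have pol u v : u ∘ v = - (v ∘ u).
    apply/eqP; rewrite -subr_eq0 opprK; have := sq0 (u + v).
    by rewrite !(prE fp) !sq0 add0r addr0 => ->.
  have pol0 u v : om (u ∘ v) v = 0.
    have := fp_cyc fp u v v; rewrite sq0 (om0l fp) (fp_sym fp v u) sq0 (om0l fp); lra.
  have := pol0 x (y + z); rewrite !(prE fp) !(omE fp) !pol0 (fp_sym fp x z y); lra.
have [q pq] := exists_dual fp pp0.
(* Subtracting (t / 2) p kills omega(p.q, q); adding a multiple of the central vector p.q1 then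
   makes the result orthogonal to p without changing its product with p. *)
pose t := om (p ∘ q) q; pose q1 := q - (t / 2) *: p.
have pq1 : om (p ∘ p) q1 = 1 by rewrite !(omE fp) pq ppp; ring.
have qq1 : om (p ∘ q1) q1 = 0.
  by rewrite !(prE fp) !(omE fp) -/t ppp pq (fp_sym fp p q p) pq; field.
pose q2 := q1 + om p q1 *: (p ∘ q1).
have pE : p ∘ q2 = p ∘ q1 by rewrite (prDr fp) (prZr fp) cent scaler0 addr0.
exists p, q2; split => //.
- by rewrite (omDr fp) pq1 (omZr fp) iso mulr0 addr0.
- by rewrite pE (omDr fp) qq1 (omZr fp) iso mulr0 addr0.
rewrite (omDr fp) (omZr fp) (fp_om_skew fp p (p ∘ q1)) (fp_sym fp) pq1; ring.
Qed.

End Dim4.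

(** * Lifting a reduction with nonzero product *)

Section NonAbelianReduction.
Variables (R : realFieldType) (V : vectType R).
Variables (om : V -> V -> R) (pr : V -> V -> V).
Hypothesis fp : flat_product om pr.
Local Notation "u ∘ v" := (pr u v) (at level 40, left associativity).
Hypothesis dimV : \dim {:V} = 6.
Variables e f p q e2 e3 : V.
Hypothesis eZ : central pr e.
Local Notation H x := (om x e = 0).
Hypotheses (ef : om e f = 1) (e2p : om e2 p = 1) (e3q : om e3 q = 1).
Hypotheses (pe : H p) (qe : H q) (e2e : H e2) (e3e : H e3).
Hypotheses (pf : om p f = 0) (qf : om q f = 0) (e2f : om e2 f = 0) (e3f : om e3 f = 0).
Hypotheses (pq : om p q = 0) (e2q : om e2 q = 0) (e3p : om e3 p = 0) (e23 : om e2 e3 = 0).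
Hypotheses (ppq : om (p ∘ p) q = 1) (pqq : om (p ∘ q) q = 0).
Hypothesis Z2 : forall x z, H x -> H z -> om (x ∘ e2) z = 0.
Hypothesis Z3 : forall x z, H x -> H z -> om (x ∘ e3) z = 0.

Let fe : om f e = -1. Proof. by rewrite (fp_om_skew fp) ef. Qed.
Let pe2 : om p e2 = -1. Proof. by rewrite (fp_om_skew fp) e2p. Qed.
Let qe3 : om q e3 = -1. Proof. by rewrite (fp_om_skew fp) e3q. Qed.
Let ep : om e p = 0. Proof. by rewrite (fp_om_skew fp) pe oppr0. Qed.
Let e_q : om e q = 0. Proof. by rewrite (fp_om_skew fp) qe oppr0. Qed.
Let ee2 : om e e2 = 0. Proof. by rewrite (fp_om_skew fp) e2e oppr0. Qed.
Let ee3 : om e e3 = 0. Proof. by rewrite (fp_om_skew fp) e3e oppr0. Qed.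
Let fp0 : om f p = 0. Proof. by rewrite (fp_om_skew fp) pf oppr0. Qed.
Let fq : om f q = 0. Proof. by rewrite (fp_om_skew fp) qf oppr0. Qed.
Let fe2 : om f e2 = 0. Proof. by rewrite (fp_om_skew fp) e2f oppr0. Qed.
Let fe3 : om f e3 = 0. Proof. by rewrite (fp_om_skew fp) e3f oppr0. Qed.
Let qp : om q p = 0. Proof. by rewrite (fp_om_skew fp) pq oppr0. Qed.
Let qe2 : om q e2 = 0. Proof. by rewrite (fp_om_skew fp) e2q oppr0. Qed.
Let pe3 : om p e3 = 0. Proof. by rewrite (fp_om_skew fp) e3p oppr0. Qed.
Let e32 : om e3 e2 = 0. Proof. by rewrite (fp_om_skew fp) e23 oppr0. Qed.
Let frameE := (ef, e2p, e3q, pe, qe, e2e, e3e, pf, qf, e2f, e3f, (pq, e2q, e3p, e23),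
  (fe, pe2, qe3, ep, e_q, ee2, ee3, fp0, fq, fe2, fe3, (qp, qe2, pe3, e32)), omuu fp).

(* In the nonabelian case e^perp / e has basis p, q, e2 = p.q, e3 = p.p, where e2 *)
(* and e3 are central; [xi x y] is omega(x.f, y) and [b x] is omega(f.f, x).      *)
Lemma frame_nondeg v : om v e = 0 -> om v f = 0 -> om v p = 0 -> om v e2 = 0 ->
  om v q = 0 -> om v e3 = 0 -> v = 0.
Proof.
move=> ve vf vp v2 vq v3.
have fr : free [:: e; f; e2; p; e3; q].
  apply: free6P => k1 k2 k3 k4 k5 k6 E; have Ew w := congr1 (om^~ w) E.
  move: (Ew e) (Ew f) (Ew p) (Ew q) (Ew e2) (Ew e3).
  rewrite !(omE fp) !frameE => *; split; [lra|lra|lra|split; lra].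
apply: (orth_span fp fr) => [|x]; first by rewrite dimV.
by rewrite !inE => /or3P [/eqP->|/eqP->|/or4P [] /eqP->].
Qed.

Lemma frame_eq v w : om v e = om w e -> om v f = om w f -> om v p = om w p ->
  om v e2 = om w e2 -> om v q = om w q -> om v e3 = om w e3 -> v = w.
Proof.
move=> ve vf vp v2 vq v3; apply/eqP; rewrite -subr_eq0; apply/eqP.
by apply: frame_nondeg; rewrite !(omE fp) ?ve ?vf ?vp ?v2 ?vq ?v3 subrr.
Qed.

Lemma frame_expand x : H x -> x = om x f *: e + (om x p *: e2 - om x e2 *: p)
  + (om x q *: e3 - om x e3 *: q).
Proof. by move=> xe; apply: frame_eq; rewrite !(omE fp) !frameE ?xe; ring. Qed.

Let prH x y : H (x ∘ y). Proof. exact: (central_om fp eZ). Qed.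

Let om_expand x y : H x -> H y -> om x y = om x e2 * om y p - om x p * om y e2
  + (om x e3 * om y q - om x q * om y e3).
Proof.
move=> xe ye; rewrite {1}(frame_expand xe) !(omE fp) (fp_om_skew fp e) ye.
rewrite (fp_om_skew fp e2) (fp_om_skew fp p) (fp_om_skew fp e3) (fp_om_skew fp q); ring.
Qed.

Let T_expand x w z : H x -> om (x ∘ w) z =
  om x p * om (e2 ∘ w) z - om x e2 * om (p ∘ w) z
  + (om x q * om (e3 ∘ w) z - om x e3 * om (q ∘ w) z).
Proof.
move=> xe; rewrite {1}(frame_expand xe) !(prE fp) (central_l fp _ eZ) scaler0 add0r.
by rewrite !(omE fp).
Qed.

(* Flatness paired with z, all products being expanded in the symplectic frame. *)
Definition flatness_eq u v w z :=
  om (u ∘ w) e2 * om (v ∘ z) p - om (u ∘ w) p * om (v ∘ z) e2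
  + (om (u ∘ w) e3 * om (v ∘ z) q - om (u ∘ w) q * om (v ∘ z) e3)
  - (om (v ∘ w) e2 * om (u ∘ z) p - om (v ∘ w) p * om (u ∘ z) e2
  + (om (v ∘ w) e3 * om (u ∘ z) q - om (v ∘ w) q * om (u ∘ z) e3))
  = om (u ∘ v) p * om (e2 ∘ w) z - om (u ∘ v) e2 * om (p ∘ w) z
  + (om (u ∘ v) q * om (e3 ∘ w) z - om (u ∘ v) e3 * om (q ∘ w) z)
  - (om (v ∘ u) p * om (e2 ∘ w) z - om (v ∘ u) e2 * om (p ∘ w) z
  + (om (v ∘ u) q * om (e3 ∘ w) z - om (v ∘ u) e3 * om (q ∘ w) z)).

Lemma flatnessP u v w z : flatness_eq u v w z.
Proof.
rewrite /flatness_eq -!om_expand // -!T_expand //.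
have := congr1 (om^~ z) (fp_lsa fp u v w); rewrite !(omE fp).
by rewrite (om_adjL fp u (v ∘ w)) (om_adjL fp v (u ∘ w)); lra.
Qed.

Let ppp : om (p ∘ p) p = 0. Proof. by have := fp_cyc fp p p p; lra. Qed.
Let qqq : om (q ∘ q) q = 0. Proof. by have := fp_cyc fp q q q; lra. Qed.
Let fff : om (f ∘ f) f = 0. Proof. by have := fp_cyc fp f f f; lra. Qed.
Let pqp : om (p ∘ q) p = 1. Proof. by rewrite (fp_sym fp). Qed.
Let qpp : om (q ∘ p) p = -2.
Proof. by have := fp_cyc fp p p q; rewrite ppq pqp; lra. Qed.
Let qqp : om (q ∘ q) p = 0.
Proof. by have := fp_cyc fp q q p; rewrite (fp_sym fp q p) pqq; lra. Qed.
Let qpq : om (q ∘ p) q = 0. Proof. by rewrite (fp_sym fp). Qed.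
Let Z2r x z : H x -> H z -> om (x ∘ z) e2 = 0.
Proof. by move=> xe ze; rewrite (fp_sym fp) Z2. Qed.
Let Z3r x z : H x -> H z -> om (x ∘ z) e3 = 0.
Proof. by move=> xe ze; rewrite (fp_sym fp) Z3. Qed.
Let Z2l x z : H x -> H z -> om (e2 ∘ x) z = 0.
Proof. by move=> xe ze; have := fp_cyc fp e2 x z; rewrite Z2r // Z2 //; lra. Qed.
Let Z3l x z : H x -> H z -> om (e3 ∘ x) z = 0.
Proof. by move=> xe ze; have := fp_cyc fp e3 x z; rewrite Z3r // Z3 //; lra. Qed.
Let lastf x z : om (x ∘ z) f = om (x ∘ f) z. Proof. exact: (fp_sym fp). Qed.
Let firstf x z : om (f ∘ x) z = - (om (x ∘ f) z + om (z ∘ f) x).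
Proof. by have := fp_cyc fp f x z; rewrite lastf; lra. Qed.

Local Notation xi x y := (om (x ∘ f) y).
Local Notation b x := (om (f ∘ f) x).

Let Bvals := (ppp, qqq, ppq, pqp, qpp, qqp, pqq, qpq).
Let Tvals := (Bvals, (Z2 pe pe, Z2 pe qe, Z2 qe pe, Z2 qe qe, Z2 e2e pe, Z2 e2e qe, Z2 e3e pe, Z2 e3e qe),
  (Z2 pe e2e, Z2 pe e3e, Z2 qe e2e, Z2 qe e3e, Z2 e2e e2e, Z2 e2e e3e, Z2 e3e e2e, Z2 e3e e3e),
  (Z3 pe pe, Z3 pe qe, Z3 qe pe, Z3 qe qe, Z3 e2e pe, Z3 e2e qe, Z3 e3e pe, Z3 e3e qe),
  (Z3 pe e2e, Z3 pe e3e, Z3 qe e2e, Z3 qe e3e, Z3 e2e e2e, Z3 e2e e3e, Z3 e3e e2e, Z3 e3e e3e),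
  (Z2l pe pe, Z2l pe qe, Z2l qe pe, Z2l qe qe, Z3l pe pe, Z3l pe qe, Z3l qe pe, Z3l qe qe),
  (Z2r pe pe, Z2r pe qe, Z2r qe pe, Z2r qe qe, Z3r pe pe, Z3r pe qe, Z3r qe pe, Z3r qe qe),
  (Z2r e2e pe, Z2r e2e qe, Z2r e3e pe, Z2r e3e qe, Z3r e2e pe, Z3r e2e qe, Z3r e3e pe, Z3r e3e qe)).
Let lasts := (lastf p p, lastf p q, lastf p e2, lastf p e3, lastf q p, lastf q q, lastf q e2, lastf q e3,
  (lastf e2 p, lastf e2 q, lastf e2 e2, lastf e2 e3, lastf e3 p, lastf e3 q, lastf e3 e2, lastf e3 e3),
  (lastf f p, lastf f q, lastf f e2, lastf f e3), fff,
  (om_xff fp f p, om_xff fp f q, om_xff fp f e2, om_xff fp f e3)).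
Let firsts := (firstf p p, firstf p q, firstf p e2, firstf p e3, firstf q p, firstf q q, firstf q e2, firstf q e3,
  (firstf e2 p, firstf e2 q, firstf e2 e2, firstf e2 e3, firstf e3 p, firstf e3 q, firstf e3 e2, firstf e3 e3)).
Ltac flat_eq u v w z := have := flatnessP u v w z; rewrite /flatness_eq ?lasts ?firsts ?Tvals.

(** Flatness on frame vectors is first used where it is linear in the unknown entries, then where it
    says that the square of an entry is zero. Among the entries of xi involving e2 or e3, only
    xi(e3, p) survives. *)
Let x22 : xi e2 e2 = 0. Proof. by flat_eq p q e2 f; lra. Qed.
Let x23 : xi e2 e3 = 0. Proof. by flat_eq p q e3 f; lra. Qed.
Let x33 : xi e3 e3 = 0. Proof. by flat_eq p e3 p f; lra. Qed.
Let x32 : xi e3 e2 = 0. Proof. by flat_eq p e3 q f; lra. Qed.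
Let xp3 : xi p e3 = 0. Proof. by flat_eq p f p p; lra. Qed.
Let x2q : xi e2 q = 0. Proof. by flat_eq q f p q; lra. Qed.
Let xq2 : xi q e2 = 0. Proof. by flat_eq p q q f; rewrite x2q; lra. Qed.
Let lin1 := (x22, x23, x33, x32, xp3, x2q, xq2).

Let sqr0 (x : R) : x * x = 0 -> x = 0.
Proof. by move/eqP; rewrite mulf_eq0 orbb => /eqP. Qed.

Let xp2 : xi p e2 = 0.
Proof. by apply: sqr0; flat_eq p f e2 f; rewrite !lin1; lra. Qed.
Let xq3 : xi q e3 = 0.
Proof. by apply: sqr0; flat_eq q f e3 f; rewrite !lin1; lra. Qed.
Let x2p : xi e2 p = 0.
Proof. by apply: sqr0; flat_eq e2 f p f; rewrite !lin1; lra. Qed.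
Let x3q : xi e3 q = 0.
Proof. by apply: sqr0; flat_eq e3 f q f; rewrite !lin1; lra. Qed.
Let lin := (lin1, (xp2, xq3, x2p, x3q)).

Let b2 : b e2 = 0. Proof. by flat_eq p q f f; rewrite ?lin; lra. Qed.
Let b3 : b e3 = - (xi e3 p * xi p q). Proof. by flat_eq p f p f; rewrite ?lin; lra. Qed.
Let sxqq : xi e3 p * xi q q = 0.
Proof. by flat_eq p f q f; rewrite ?lin ?b2; lra. Qed.
Let sbq : xi e3 p * b q = - (xi e3 p * xi p q * (xi p q + xi q p)).
Proof. by flat_eq p f f f; rewrite ?lin ?b2 ?b3; lra. Qed.


Let orth_products c : H c -> c ∘ f = 0 -> b c = 0 ->
  (forall h k, H h -> H k -> om (h ∘ k) c = 0) -> (forall h, H h -> om (h ∘ f) c = 0) ->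
  forall u v, om (u ∘ v) c = 0.
Proof.
move=> ce cf bc hk hf.
have dec u : exists2 h, H h & exists k, u = h + k *: f.
  exists (u + om u e *: f); first by rewrite !(omE fp) fe; ring.
  by exists (- om u e); rewrite scaleNr addrK.
move=> u v; have [h hh [k ->]] := dec u; have [h' hh' [k' ->]] := dec v.
rewrite !(prE fp) !(omE fp) hk // hf // bc (firstf h' c) hf // cf (om0l fp).
by ring.
Qed.

Let Hdec h : H h -> om (h ∘ f) e2 = 0 /\ om (h ∘ f) e3 = 0.
Proof. by move=> he; rewrite !(T_expand _ _ he) !lin; split; ring. Qed.

(** Now e2.f = e3.f = 0, and e2 and e3 are orthogonal to all products, which therefore lie in the
    isotropic span of e, e2 and e3. *)
Lemma nonabelian_products_isotropic : xi e3 p = 0 -> forall u v w x, om (u ∘ v) (w ∘ x) = 0.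
Proof.
move=> s0.
have e2f0 : e2 ∘ f = 0.
  by apply: frame_nondeg; rewrite ?prH ?(om_xff fp) ?lin ?b2 //; ring.
have e3f0 : e3 ∘ f = 0.
  by apply: frame_nondeg; rewrite ?prH ?(om_xff fp) ?lin ?b3 ?s0 //; ring.
have b30 : b e3 = 0 by rewrite b3 s0 mul0r oppr0.
have c2 := orth_products e2e e2f0 b2 Z2r (fun h hh => proj1 (Hdec hh)).
have c3 := orth_products e3e e3f0 b30 Z3r (fun h hh => proj2 (Hdec hh)).
by move=> u v w x; rewrite om_expand ?prH // !c2 !c3; ring.
Qed.

(** Dividing [sxqq] and [sbq] by s = xi(e3, p) determines xi(q, q) and omega(f.f, q), so that all
    brackets are explicit in s, t, r, c, d. *)
Lemma nonabelian_G6_3 : xi e3 p <> 0 -> exists l, structure_table (bracket pr) G6_3 l.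
Proof.
move=> /eqP s0.
have [s sE] : exists s, xi e3 p = s by eexists.
have [t tE] : exists t, xi p q = t by eexists.
have [r rE] : exists r, xi q p = r by eexists.
have xqq : xi q q = 0.
  by apply/eqP; have /eqP := sxqq; rewrite mulf_eq0 (negPf s0).
have bq : b q = - (t * (t + r)).
  apply: (mulfI s0); rewrite sbq tE rE; ring.
rewrite sE in s0; have [c cE] : exists c, b p = c by eexists.
have [d dE] : exists d, xi p p = d by eexists.
have b3' : b e3 = - (s * t) by rewrite b3 sE tE.
(* This is [f, p] in the frame. *)
pose y := (3 * c) *: e - (3 * d) *: e2 - (2 * t + r) *: e3 + s *: q.
pose vals := (sE, tE, rE, xqq, bq, cE, dE, b3', b2, lin, frameE).
(* Replacing f by f - t p aligns [x2, x3] with [x1, x4]: both become - 3 s (e2 + t e). *)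
exists [:: p; f - t *: p; (3 / 2) *: e3; - y; (- (3 / 2) * s) *: e;
  (- 3 * s) *: (e2 + t *: e)]; split=> //.
  apply: free6P => k1 k2 k3 k4 k5 k6 E; have Ew w := congr1 (om^~ w) E.
  have k20 : k2 = 0 by have := Ew e; rewrite /y !(omE fp) !frameE; lra.
  have k10 : k1 = 0 by have := Ew e2; rewrite /y !(omE fp) !frameE k20; lra.
  have k40 : k4 = 0.
    by have := Ew e3; rewrite /y !(omE fp) !frameE k20 k10 => E3; apply: (mulfI s0); lra.
  have k30 : k3 = 0 by have := Ew q; rewrite /y !(omE fp) !frameE k20 k10 k40; lra.
  have k60 : k6 = 0.
    by have := Ew p; rewrite /y !(omE fp) !frameE k20 k10 k40 k30 => E3; apply: (mulfI s0); lra.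
  have k50 : k5 = 0.
    by have := Ew f; rewrite /y !(omE fp) !frameE k20 k10 k40 k30 k60 => E3; apply: (mulfI s0); lra.
  by [].
have brxx x : bracket pr x x = 0 by rewrite /bracket subrr.
have brC x z : bracket pr x z = - bracket pr z x by rewrite /bracket opprB.
have bre x : bracket pr x e = 0 by rewrite /bracket eZ (central_l fp _ eZ) subrr.
have brer x : bracket pr e x = 0 by rewrite brC bre oppr0.
have brD x z w : bracket pr x (z + w) = bracket pr x z + bracket pr x w.
  by rewrite /bracket !(prE fp) opprD addrACA.
have brZ x k z : bracket pr x (k *: z) = k *: bracket pr x z.
  by rewrite /bracket !(prE fp) scalerBr.
have brN x z : bracket pr x (- z) = - bracket pr x z by rewrite -!scaleN1r brZ.
have brDl x z w : bracket pr (z + w) x = bracket pr z x + bracket pr w x.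
  by rewrite !(brC _ x) brD opprD.
have brZl x k z : bracket pr (k *: z) x = k *: bracket pr z x.
  by rewrite !(brC _ x) brZ scalerN.
have brNl x z : bracket pr (- z) x = - bracket pr z x by rewrite -!scaleN1r brZl.
have tab : [/\ bracket pr p f = - y, bracket pr p q = (t - r) *: e + 3 *: e2,
    bracket pr p e2 = 0 & bracket pr p e3 = (- s) *: e] /\
  [/\ bracket pr f q = (- 3 * (t * (t + r))) *: e - (t + 2 * r) *: e2,
    bracket pr f e2 = 0, bracket pr f e3 = (- 3 * (s * t)) *: e - (2 * s) *: e2
    & [/\ bracket pr e3 q = 0, bracket pr e3 e2 = 0 & bracket pr q e2 = 0]].
  by split; split; try split; apply: frame_eq;
    rewrite /bracket /y ?(omE fp) ?prH ?lasts ?firsts ?Tvals ?vals; ring.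
case: tab => -[bpf bpq bp2 bp3] [bfq bf2 bf3 [b3q b32 bq2]].
pose brE := (brD, brDl, brN, brNl, brZ, brZl, brxx, bre, brer).
pose brT := (bpf, bpq, bp2, bp3, bfq, bf2, bf3, b3q, b32, bq2).
case=> [|[|[|[|[|[|i]]]]]] [|[|[|[|[|[|j]]]]]] /andP[] //= _ _.
all: rewrite ?big_cons ?big_nil /= ?addr0 /y ?brE ?brT.
all: apply: (om_inj fp) => w; rewrite /y ?(omE fp); by [ring | field].
Qed.
End NonAbelianReduction.

Section Dim6.
Variables (R : realFieldType) (V : vectType R).
Variables (om : V -> V -> R) (pr : V -> V -> V).
Hypothesis fp : flat_product om pr.
Local Notation "u ∘ v" := (pr u v) (at level 40, left associativity).

Lemma dim6_dichotomy : \dim {:V} = 6 ->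
  (forall u v w x, om (u ∘ v) (w ∘ x) = 0) \/
  exists s, structure_table (bracket pr) G6_3 s.
Proof.
move=> dimV; have [|e e0 eZ] := exists_central fp; first by rewrite dimV.
have [f ef] := exists_dual fp e0; have fpB := red_flat fp eZ ef.
have dimB : \dim {: subvs_of (redspace fp e f)} = 4 by apply: redspace_dim.
have dim8 : (\dim {:V} < 8)%N by rewrite dimV.
have [ab|] := pselect (forall x y z : subvs_of (redspace fp e f), red_om (red_pr x y) z = 0).
  have abV x y z : om x e = 0 -> om y e = 0 -> om z e = 0 -> om (x ∘ y) z = 0.
    by move=> xe ye ze; rewrite -(red_pr_om fp ef eZ xe ye ze) ab.
  have [c0|] := pselect (forall z, om z e = 0 -> om ((f ∘ f) ∘ f) z = 0).
    by left; apply: (abelian_products_isotropic fp eZ ef abV dim8).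
  move=> /existsNP [z /not_implyP [ze cz]]; right.
  exact: (abelian_G6_3 fp eZ ef abV dim8 ze cz).
move=> /existsNP [x /existsNP [y /existsNP [z xyz]]].
have [p [q [ppq pqq pq Zpp Zpq]]] := dim4_normal_form fpB dimB xyz.
have vP w : om (vsval w) e = 0 /\ om (vsval w) f = 0 := redspaceP fp e f _ (subvsP w).
pose e2 := red_pr p q; pose e3 := red_pr p p.
have Zval a : central (@red_pr _ _ _ _ fp e f) a ->
    forall u w, om u e = 0 -> om w e = 0 -> om (u ∘ vsval a) w = 0.
  move=> aZ u w ue we; have [ae af] := vP a.
  rewrite -(red_pr_om fp ef eZ ue ae we).
  have -> : redelt fp ef (vsval a) = a.
    by apply: val_inj; rewrite /= redelt_val (redproj_id (fp := fp)) // subvsP.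
  by rewrite aZ (om0l fpB).
have rE a b c : om (vsval a ∘ vsval b) (vsval c) = red_om (@red_pr _ _ _ _ fp e f a b) c.
  by rewrite (red_prP (fp := fp) ef).
have e2p : om (vsval e2) (vsval p) = 1 by rewrite -ppq -[LHS]/(red_om e2 p) (fp_sym fpB).
have e3p : om (vsval e3) (vsval p) = 0.
  by rewrite -[LHS]/(red_om e3 p); have := fp_cyc fpB p p p; rewrite -/e3; lra.
have e23 : om (vsval e2) (vsval e3) = 0.
  by rewrite -[LHS]/(red_om e2 e3) (fp_sym fpB) Zpp (om0l fpB).
have ppq' : om (vsval p ∘ vsval p) (vsval q) = 1 by rewrite rE.
have pqq' : om (vsval p ∘ vsval q) (vsval q) = 0 by rewrite rE.
have [[pe pf] [qe qf] [e2e e2f] [e3e e3f]] :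
  [/\ om (vsval p) e = 0 /\ om (vsval p) f = 0, om (vsval q) e = 0 /\ om (vsval q) f = 0,
    om (vsval e2) e = 0 /\ om (vsval e2) f = 0 & om (vsval e3) e = 0 /\ om (vsval e3) f = 0].
  by split; apply: vP.
have [s0|s0] := pselect (om (vsval e3 ∘ f) (vsval p) = 0); [left | right].
  exact: (nonabelian_products_isotropic fp dimV eZ ef e2p ppq pe qe e2e e3e pf qf e2f e3f
    pq pqq e3p e23 ppq' pqq' (Zval _ Zpq) (Zval _ Zpp) s0).
exact: (nonabelian_G6_3 fp dimV eZ ef e2p ppq pe qe e2e e3e pf qf e2f e3f
    pq pqq e3p e23 ppq' pqq' (Zval _ Zpq) (Zval _ Zpp) s0).
Qed.

End Dim6.

(** * Central product space: normal forms *)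

Lemma free_completion (R : fieldType) (V : vectType R) (W : {vspace V}) d (s : seq V) :
  free s -> {subset s <= W} -> (size s + d <= \dim W)%N ->
  exists t, [/\ size t = d, free (t ++ s) & {subset t <= W}].
Proof.
elim: d s => [|d IHd] s fs sW le; first by exists [::].
have [w wW ws] : exists2 w, w \in W & w \notin <<s>>%VS.
  apply/subvPn; apply: contraL le => Ws; rewrite -ltnNge addnS ltnS.
  by rewrite (leq_trans (dimvS Ws)) // (eqP fs) leq_addr.
have [| | |t [szt ft tW]] := IHd (w :: s).
- by rewrite free_cons ws.
- by move=> x; rewrite inE => /orP [/eqP->|/sW].
- by rewrite /= addSnnS.
exists (rcons t w); split; rewrite ?size_rcons ?szt ?cat_rcons // => x.
by rewrite mem_rcons inE => /orP [/eqP->|/tW].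
Qed.

Section IsotropicProducts.
Variables (R : realFieldType) (V : vectType R).
Variables (om : V -> V -> R) (pr : V -> V -> V).
Hypothesis fp : flat_product om pr.
Local Notation "u ∘ v" := (pr u v) (at level 40, left associativity).
Hypothesis dimV : \dim {:V} = 6.
Hypothesis iso : forall u v w x, om (u ∘ v) (w ∘ x) = 0.
Local Notation br := (bracket pr).

(** The span P of the products is isotropic, so its dimension is at most 3 and that of its
    orthogonal at least 3. The orthogonal is central and contains P; K is chosen between the two. *)
Lemma central_subspace : exists K : {vspace V},
  [/\ \dim K = 3, forall u v, u ∘ v \in K & forall k, k \in K -> central pr k].
Proof.
pose B := vbasis {:V}.
pose P := <<[seq x ∘ y | x <- B, y <- B]>>%VS.
have BE v : v = \sum_i coord B i v *: B`_i.
  exact: (coord_basis (vbasisP _) (memvf _)).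
have PP u v : u ∘ v \in P.
  rewrite [u]BE [v]BE (big_morph (pr^~ _) (fun x y => prDl fp x y _) (pr0l fp _)).
  apply: memv_suml => i _; rewrite (prZl fp); apply: memvZ.
  rewrite (big_morph (pr _) (fun x y => prDr fp x y _) (pr0r fp _)).
  apply: memv_suml => j _; rewrite (prZr fp); apply: memvZ.
  by apply/memv_span/allpairsP; exists (B`_i, B`_j); split; rewrite ?mem_nth ?size_tuple.
have Pom u : (forall x y, om (x ∘ y) u = 0) -> forall p, p \in P -> om p u = 0.
  move=> u0 p; pose s := [seq x ∘ y | x <- B, y <- B].
  rewrite -[P]/(<<tval (in_tuple s)>>%VS) => /coord_span ->.
  rewrite (big_morph (om^~ u) (fun x y => omDl fp x y u) (om0l fp u)) big1 // => i _.
  rewrite (omZl fp); have /allpairsP [[x y] [_ _ ->]] : (in_tuple s)`_i \in s by apply: mem_nth.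
  by rewrite u0 mulr0.
have Piso : {in P &, forall x y, om x y = 0}.
  move=> x y xP yP; apply: (Pom _ _ _ xP) => a b; rewrite (fp_om_skew fp).
  by rewrite (Pom _ _ _ yP) ?oppr0 // => c d; apply: iso.
have dimP : (\dim P <= 3)%N.
  have := isotropic_size fp (basis_free (vbasisP P)).
  rewrite size_tuple dimV -[6]/(3.*2) leq_double; apply=> x y xP yP.
  by apply: Piso; apply: vbasis_mem.
pose phi (x : V) : 'rV[R]_(\dim P) := \row_i om x (vbasis P)`_i.
have phil : linear phi by move=> a x y; apply/rowP => i; rewrite !mxE (fp_om_linl fp).
pose Phi := linfun (HB.pack_for {linear V -> 'rV[R]_(\dim P)} phi
  (GRing.isLinear.Build _ _ _ _ phi phil)).
have PhiE x : Phi x = phi x by rewrite lfunE.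
have dimZ : (3 <= \dim (lker Phi))%N.
  have := limg_ker_dim Phi fullv; rewrite capfv dimV => dE.
  have le : (\dim (Phi @: fullv) <= 3)%N.
    rewrite (leq_trans _ dimP) //; apply: leq_trans (dimvS (subvf _)) _.
    by rewrite dimvf /dim /= mul1n.
  by rewrite -(leq_add2r (\dim (Phi @: fullv))) dE -[6]/(3 + 3)%N leq_add2l.
have Zc k : k \in lker Phi -> central pr k.
  rewrite memv_ker => /eqP k0 u; apply: (fp_om_nondeg fp) => w.
  rewrite (om_adjL fp); have : u ∘ w \in P by [].
  move/(coord_basis (vbasisP P)) => ->.
  rewrite (big_morph (om k) (fun x y => omDr fp x y k) (om0r fp k)) big1 ?oppr0 // => i _.
  rewrite (omZr fp); have := congr1 (fun r : 'rV[R]_(\dim P) => r 0 i) k0.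
  by rewrite PhiE !mxE => ->; rewrite mulr0.
have PZ x : x \in P -> x \in lker Phi.
  move=> xP; rewrite memv_ker PhiE; apply/eqP/rowP => i; rewrite !mxE.
  by apply: Piso => //; apply/vbasis_mem/mem_nth; rewrite size_tuple.
have [| | |t [szt ft tZ]] := @free_completion _ _ (lker Phi) (3 - \dim P) (vbasis P).
- exact: basis_free (vbasisP P).
- by move=> x /vbasis_mem /PZ.
- by rewrite size_tuple subnKC.
exists <<t ++ vbasis P>>%VS; split.
- by rewrite (eqP ft) size_cat szt size_tuple subnK.
- move=> u v; rewrite span_cat (span_basis (vbasisP P)).
  by rewrite (subvP (addvSr _ _)).
move=> k kK; apply: Zc; apply: subvP kK; apply/span_subvP => x.
by rewrite mem_cat => /orP [/tZ|/vbasis_mem /PZ].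
Qed.

Let br_skew x y : br x y = - br y x.
Proof. by rewrite /bracket opprB. Qed.
Let brZr k x y : br x (k *: y) = k *: br x y.
Proof. by rewrite /bracket !(prE fp) scalerBr. Qed.
Let brDr x y z : br x (y + z) = br x y + br x z.
Proof. by rewrite /bracket !(prE fp) opprD addrACA. Qed.
Let brxx x : br x x = 0. Proof. by rewrite /bracket subrr. Qed.
Ltac vring := apply: (om_inj fp) => ?; rewrite ?(omE fp); ring.

Section Generators.
Variable K : {vspace V}.
Hypotheses (dimK : \dim K = 3) (KP : forall u v, u ∘ v \in K).
Hypothesis KZ : forall k, k \in K -> central pr k.

Definition generate_mod x1 x2 x3 :=
  forall v, exists a1 a2 a3, v - (a1 *: x1 + a2 *: x2 + a3 *: x3) \in K.

Let brK u v : br u v \in K. Proof. by rewrite memvB. Qed.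
Let brZ0 x k : k \in K -> br x k = 0.
Proof. by move=> /KZ kZ; rewrite /bracket kZ (central_l fp _ kZ) subrr. Qed.

Lemma generate_change x1 x2 x3 y1 y2 y3 : generate_mod x1 x2 x3 ->
  (exists a b c, x1 = a *: y1 + b *: y2 + c *: y3) ->
  (exists a b c, x2 = a *: y1 + b *: y2 + c *: y3) ->
  (exists a b c, x3 = a *: y1 + b *: y2 + c *: y3) -> generate_mod y1 y2 y3.
Proof.
move=> gx [a [b [c x1E]]] [a' [b' [c' x2E]]] [a'' [b'' [c'' x3E]]] v.
have [r [r' [r'' vK]]] := gx v.
exists (r * a + r' * a' + r'' * a''), (r * b + r' * b' + r'' * b''),
  (r * c + r' * c' + r'' * c'').
by apply: (eq_ind _ (fun z => z \in K) vK); rewrite x1E x2E x3E; vring.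
Qed.

(** Every table except that of [G6_3] only has brackets among x1, x2, x3; the other entries hold
    because K is central. *)
Lemma generate_table m x1 x2 x3 k1 k2 k3 (s := [:: x1; x2; x3; k1; k2; k3]) :
  generate_mod x1 x2 x3 -> free [:: k1; k2; k3] -> {subset [:: k1; k2; k3] <= K} ->
  m <> G6_3 ->
  [/\ br x1 x2 = \sum_(t <- flat6_table m | t.1 == (1, 2)) s`_(t.2.-1),
      br x1 x3 = \sum_(t <- flat6_table m | t.1 == (1, 3)) s`_(t.2.-1) &
      br x2 x3 = \sum_(t <- flat6_table m | t.1 == (2, 3)) s`_(t.2.-1)] ->
  structure_table br m s.
Proof.
move=> gx fk kK mN [b12 b13 b23].
have KE : <<[:: k1; k2; k3]>>%VS = K.
  by apply/eqP; rewrite eqEdim (eqP fk) dimK leqnn andbT; apply/span_subvP.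
split=> //.
  rewrite /free -[size s]dimV eqn_leq dimvS ?subvf //=; apply: dimvS.
  apply/subvP => v _; have [a [b [c]]] := gx v; rewrite -KE => vK.
  rewrite -[v](subrK (a *: x1 + b *: x2 + c *: x3)) addrC.
  rewrite (_ : s = [:: x1; x2; x3] ++ [:: k1; k2; k3]) // span_cat memv_add //.
  by rewrite !memvD // memvZ // memv_span // !inE eqxx ?orbT.
have [k1K k2K k3K] : [/\ k1 \in K, k2 \in K & k3 \in K].
  by split; apply: kK; rewrite !inE eqxx ?orbT.
case=> [|[|[|[|[|[|i]]]]]] [|[|[|[|[|[|j]]]]]] /andP[] //= _ _.
all: rewrite ?brZ0 //; case: m mN {b12 b13 b23} => //= _; by rewrite ?big_cons ?big_nil.
Qed.

Lemma free_dependent2 (x y : V) : ~~ free [:: x; y] ->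
  exists a b, a *: x + b *: y = 0 /\ (a != 0 \/ b != 0).
Proof.
rewrite free_cons seq1_free span_seq1 negb_and !negbK => /orP [/vlineP [k ->]|/eqP->].
  by exists 1, (- k); rewrite scale1r scaleNr subrr; split=> //; left; apply: oner_neq0.
by exists 0, 1; rewrite scale0r scaler0 addr0; split=> //; right; apply: oner_neq0.
Qed.

Lemma free_dependent3 (x y z : V) : ~~ free [:: x; y; z] ->
  exists a b c, a *: x + b *: y + c *: z = 0 /\ [\/ a != 0, b != 0 | c != 0].
Proof.
rewrite free_cons negb_and negbK => /orP [|/free_dependent2 [b [c [E bc]]]].
  rewrite span_cons span_seq1 => /memv_addP [_ /vlineP [k ->] [_ /vlineP [l ->] ->]].
  exists 1, (- k), (- l); split; last by constructor 1; apply: oner_neq0.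
  by vring.
exists 0, b, c; rewrite scale0r add0r; split=> //.
by case: bc; [constructor 2 | constructor 3].
Qed.

(** The cases follow the rank of the map induced by the bracket from the bivectors of g / K to K. *)
Lemma generators_classification x1 x2 x3 : generate_mod x1 x2 x3 ->
  exists m s, structure_table br m s.
Proof.
move=> gx.
have sub3 u v w : u \in K -> v \in K -> w \in K -> {subset [:: u; v; w] <= K}.
  by move=> uK vK wK z; rewrite !inE => /or3P [] /eqP->.
have [f3|/free_dependent3 [a [b [c [E abc]]]]] :=
    boolP (free [:: br x1 x2; br x1 x3; br x2 x3]).
  exists G6_1, [:: x1; x2; x3; br x1 x2; br x1 x3; br x2 x3].
  apply: generate_table => //; first exact: sub3.
  by rewrite !big_cons !big_nil /= !addr0.
(* The dependency is a bivector in three dimensions with zero bracket; such a bivector is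
   decomposable, and its factors serve as y2 and y3. *)
have [y1 [y2 [y3 [gy y23]]]] : exists y1 y2 y3, generate_mod y1 y2 y3 /\ br y2 y3 = 0.
  have [a0|a0] := eqVneq a 0; last first.
    exists x3, (x1 - (c / a) *: x3), (a *: x2 + b *: x3); split.
      apply: (generate_change gx); [exists (c / a), 1, 0|exists (- (b / a)), 0, a^-1|exists 1, 0, 0];
        apply: (om_inj fp) => w; rewrite !(omE fp); by field.
    rewrite -E brDr !brZr; apply: (om_inj fp) => w; rewrite /bracket !(prE fp) !(omE fp); by field.
  have [b0|b0] := eqVneq b 0; last first.
    exists x2, (b *: x1 + c *: x2), x3; split.
      apply: (generate_change gx); [exists (- (c / b)), b^-1, 0|exists 1, 0, 0|exists 0, 0, 1];
        apply: (om_inj fp) => w; rewrite !(omE fp); by field.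
    by rewrite -E a0 /bracket; apply: (om_inj fp) => w; rewrite !(prE fp) !(omE fp); ring.
  have c0 : c != 0 by case: abc; rewrite ?a0 ?b0 ?eqxx.
  exists x1, x2, x3; split=> //; move: E; rewrite a0 b0 !scale0r !add0r => /eqP.
  by rewrite scaler_eq0 (negPf c0) => /eqP.
have [f2|/free_dependent2 [{}a [{}b [{abc}E ab]]]] := boolP (free [:: br y1 y2; br y1 y3]).
  have [| |t [szt ft tK]] := @free_completion _ _ K 1 _ f2.
  - by move=> x; rewrite !inE => /orP [] /eqP->.
  - by rewrite dimK.
  case: t szt ft tK => [|k [|]] // _ fk kK.
  have kK' : k \in K by apply: kK; rewrite inE.
  exists G6_2, [:: y1; y2; y3; k; br y1 y2; br y1 y3].
  apply: generate_table => //; first exact: sub3.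
  by rewrite !big_cons !big_nil /= !addr0.
(* A combination of y2 and y3 that commutes with y1 commutes with all generators and becomes w3. *)
have [w1 [w2 [w3 [gw w13 w23]]]] :
    exists w1 w2 w3, [/\ generate_mod w1 w2 w3, br w1 w3 = 0 & br w2 w3 = 0].
  have [a0|a0] := eqVneq a 0; last first.
    exists y1, y3, (a *: y2 + b *: y3); split; last 1 first.
    - by rewrite brDr !brZr brxx br_skew y23 oppr0 !scaler0 addr0.
    - apply: (generate_change gy); [exists 1, 0, 0|exists 0, (- (b / a)), a^-1|exists 0, 1, 0];
        apply: (om_inj fp) => w; rewrite !(omE fp); by field.
    by rewrite brDr !brZr.
  have b0 : b != 0 by case: ab; rewrite ?a0 ?eqxx.
  exists y1, y2, y3; split=> //; move: E; rewrite a0 scale0r add0r => /eqP.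
  by rewrite scaler_eq0 (negPf b0) => /eqP.
have [d0|d0] := eqVneq (br w1 w2) 0.
  have [| | |t [szt ft tK]] := @free_completion _ V K 3 [::].
  - exact: nil_free.
  - by [].
  - by rewrite dimK.
  case: t szt ft tK => [|k1 [|k2 [|k3 [|]]]] // _ fk kK; rewrite cats0 in fk.
  exists R6, [:: w1; w2; w3; k1; k2; k3]; apply: generate_table => //.
  by rewrite !big_nil.
have [| | |t [szt ft tK]] := @free_completion _ V K 2 [:: br w1 w2].
- by rewrite seq1_free.
- by move=> x; rewrite inE => /eqP->.
- by rewrite dimK.
case: t szt ft tK => [|k1 [|k2 [|]]] // _ fk kK.
exists R3xH3, [:: w1; w2; w3; k1; k2; br w1 w2]; apply: generate_table => //.
  by apply: sub3 => //; apply: kK; rewrite !inE eqxx ?orbT.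
by rewrite !big_cons !big_nil /= addr0.
Qed.

End Generators.

Lemma isotropic_products_classification : exists m s, structure_table br m s.
Proof.
have [K [dimK KP KZ]] := central_subspace.
have [| | |t [szt ft _]] := @free_completion _ V fullv 3 (vbasis K).
- exact: basis_free (vbasisP K).
- by move=> x _; apply: memvf.
- by rewrite size_tuple dimK dimV.
case: t szt ft => [|x1 [|x2 [|x3 [|]]]] // _ ft.
apply: (@generators_classification K dimK KP KZ x1 x2 x3) => v.
have : v \in <<[:: x1; x2; x3] ++ vbasis K>>%VS.
  suff -> : <<[:: x1; x2; x3] ++ vbasis K>>%VS = fullv by apply: memvf.
  by apply/eqP; rewrite eqEdim subvf (eqP ft) size_cat (size_tuple (vbasis K)) dimK dimV.
rewrite span_cat (span_basis (vbasisP K)) !span_cons span_nil addv0.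
case/memv_addP => _ /memv_addP [_ /vlineP [a ->] [_ /memv_addP [_ /vlineP [b ->] [_ /vlineP [c ->] ->]] ->]].
by case=> k kK ->; exists a, b, c; apply: (eq_ind _ (fun z => z \in K) kK); vring.
Qed.

End IsotropicProducts.

Lemma flat_dim6_classification (R : realFieldType) (V : vectType R) om pr :
  @flat_product R V om pr -> \dim {:V} = 6 ->
  exists m s, structure_table (bracket pr) m s.
Proof.
move=> fp dimV; have [iso|[s sP]] := dim6_dichotomy fp dimV; last by exists G6_3, s.
exact: (isotropic_products_classification fp dimV iso).
Qed.

(** * From products to symplectic forms and tables *)

Section FlatSymplectic.
Variables (R : realFieldType) (g : lieAlgebraType R).

Lemma lieC (u v : g) : lie u v = - lie v u.
Proof.
apply/eqP; rewrite -addr_eq0; have := liexx (u + v).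
by rewrite linearDl !linearDr /= !liexx add0r addr0 => ->.
Qed.

Lemma skewC (omega : {skew_symmetric g}) u v : omega u v = - omega v u.
Proof. by rewrite hermC expr1 mulN1r. Qed.

(** Closedness of omega makes the commutator of the associated product equal to the bracket, and
    flatness then reads as left symmetry. *)
Lemma flat_symplectic_product (omega : {skew_symmetric g}) : flat_symplectic omega ->
  flat_product omega (assoc_product omega) /\
  forall u v, bracket (assoc_product omega) u v = lie u v.
Proof.
case=> -[nd closed] flat; have nd' := elimT (nondegenerateP omega) nd.
have apE u v w := assoc_productP u v w nd.
have om_inj x y : (forall w, omega x w = omega y w) -> x = y.
  move=> xy; apply/eqP; rewrite -subr_eq0; apply/eqP/nd' => w.
  by rewrite linearBl /= xy subrr.
have torsion u v : assoc_product omega u v - assoc_product omega v u = lie u v.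
  apply: om_inj => w; rewrite linearBl /= !apE.
  have := closed u v w; rewrite (lieC v u) (lieC w u) !linearNl /=.
  set a := omega _ w; set b := omega _ u; set c := omega _ v => E.
  have -> : a = c - b by move: E; rewrite -/a; lra.
  by field.
split; last by move=> u v; apply: torsion.
split.
- by move=> w a u v; rewrite linearPl.
- exact: skewC.
- exact: nd'.
- move=> w a u v; apply: om_inj => z; rewrite linearPl /= !apE !linearPl /=; ring.
- move=> w a u v; apply: om_inj => z; rewrite linearPl /= !apE !linearPr !linearPl /=; ring.
- by move=> u v w; rewrite !apE addrC.
- move=> u v w; rewrite !apE (lieC w u) (lieC v u) (lieC w v) !linearNl /=; ring.
move=> u v w; have := flat u v w; rewrite -torsion.
have ->: assoc_product omega (assoc_product omega u v - assoc_product omega v u) w =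
   assoc_product omega (assoc_product omega u v) w - assoc_product omega (assoc_product omega v u) w.
  by apply: om_inj => z; rewrite linearBl /= !apE !linearBl /=; ring.
move=> E; apply: om_inj => z; have := congr1 (omega^~ z) E; rewrite /= !linearBl /=; lra.
Qed.

(** The converse passage, where [assoc_product_uniq] identifies the given product with the
    associated one. *)
Lemma flat_product_symplectic (om : g -> g -> R) (pr : g -> g -> g) :
  flat_product om pr -> (forall u v, bracket pr u v = lie u v) ->
  exists omega : {skew_symmetric g}, flat_symplectic omega.
Proof.
move=> fp brE.
have bil : bilinear_for *%R (idfun \; *%R) om.
  by split=> [w|w] a u v; rewrite ?(fp_om_linl fp) //= (omDr fp) (omZr fp).
have herm u v : om u v = (-1) ^+ true * idfun (om v u).
  by rewrite expr1 mulN1r -(fp_om_skew fp).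
pose omega := HB.pack_for {skew_symmetric g} om
  (bilinear_isBilinear.Build R g g R *%R (idfun \; *%R) om bil)
  (isHermitianSesquilinear.Build R g true idfun om herm).
have omegaE : omega = om :> (g -> g -> R) by [].
have nd : nondegenerate omega by apply/nondegenerateP; apply: (fp_om_nondeg fp).
exists omega; split.
  split=> // u v w; rewrite omegaE -!brE /bracket !(omE fp).
  have := fp_cyc fp u v w; have := fp_sym fp u w v; have := fp_sym fp v u w.
  by have := fp_sym fp w v u; lra.
have prodE : pr =2 assoc_product omega.
  apply: assoc_product_uniq => // u v w; rewrite omegaE -!brE /bracket !(omE fp).
  by rewrite (fp_sym fp u w v) (fp_sym fp v u w); have := fp_cyc fp u v w; lra.
move=> u v w; rewrite -!prodE -brE /bracket !(prE fp).
apply: (om_inj fp) => z; have := congr1 (om^~ z) (fp_lsa fp u v w).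
by rewrite !(omE fp); lra.
Qed.

End FlatSymplectic.

(** * From a bracket table to an isomorphism with a model *)

Section TableIsomorphism.
Variables (R : realFieldType) (g : lieAlgebraType R).

Lemma flat6_table_bounds m t : t \in flat6_table m -> (0 < t.1.1 < t.1.2)%N && (t.1.2 <= 6)%N.
Proof. by move: t; apply/allP; case: m. Qed.

Lemma flat6_table_target m t : t \in flat6_table m -> (0 < t.2 <= 6)%N.
Proof. by move: t; apply/allP; case: m. Qed.

Let pick_sum (F : 'I_6 -> 'I_6 -> R) a b : (0 < a <= 6)%N -> (0 < b <= 6)%N ->
  \sum_i \sum_j F i j * ((a, b) == (i.+1, j.+1))%:R = F (inord a.-1) (inord b.-1).
Proof.
case: a b => [|a] [|b] //= a6 b6.
rewrite (bigD1 (inord a)) //= (bigD1 (inord b)) //= !inordK // eqxx mulr1.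
rewrite big1 ?addr0 => [|j jb]; last first.
  by rewrite xpair_eqE eqSS (eq_sym b.+1) eqSS -(inordK b6) (inj_eq val_inj) (negPf jb) andbF mulr0.
rewrite big1 ?addr0 // => i ia; rewrite big1 // => j _.
by rewrite xpair_eqE (eq_sym a.+1) eqSS -(inordK a6) (inj_eq val_inj) (negPf ia) mulr0.
Qed.

Lemma table_isomorphic m s : \dim {:g} = 6 ->
  structure_table (@lie R g) m s -> lie_isomorphic g (flat6 R m).
Proof.
move=> dimg [fs szs tab].
have sz : size s == 6 by apply/eqP.
pose X := Tuple sz.
have bX : basis_of fullv X by rewrite basisEfree fs subvf dimg szs.
have XE v : v = \sum_i coord X i v *: s`_i := coord_basis bX (memvf v).
have tabE (i j : 'I_6) : lie s`_i s`_j = \sum_(t <- flat6_table m)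
    ((t.1 == (i.+1, j.+1))%:R - (t.1 == (j.+1, i.+1))%:R) *: s`_(t.2.-1).
  have lt (i' j' : 'I_6) : (i' < j')%N -> lie s`_i' s`_j' = \sum_(t <- flat6_table m)
      ((t.1 == (i'.+1, j'.+1))%:R - (t.1 == (j'.+1, i'.+1))%:R) *: s`_(t.2.-1).
    move=> ij; rewrite tab ?ij ?ltn_ord // big_mkcond /= big_seq [RHS]big_seq.
    apply: eq_bigr => -[[a b] k] /flat6_table_bounds /= /andP [/andP [_ ab] _].
    have -> : ((a, b) == (j'.+1, i'.+1)) = false.
      by apply/eqP => -[aE bE]; move: ab; rewrite aE bE ltnS ltnNge (ltnW ij).
    by rewrite subr0; case: eqP => _; rewrite ?scale1r ?scale0r.
  case: (ltngtP i j) => [/lt //|/lt ji|/val_inj <-].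
    rewrite lieC ji -sumrN; apply: eq_bigr => t _.
    by rewrite -scaleNr opprB.
  by rewrite liexx big1 // => t _; rewrite subrr scale0r.
pose f (v : g) : flat6 R m := \row_i coord X i v.
have fl : linear f by move=> a u v; apply/rowP => i; rewrite !mxE linearP.
pose F := HB.pack_for {linear g -> flat6 R m} f (GRing.isLinear.Build _ _ _ _ f fl).
exists F; split.
  exists (fun a : flat6 R m => \sum_i (a : 'rV_6) 0 i *: s`_i) => [v|a].
    by rewrite [RHS]XE; apply: eq_bigr => i _; rewrite mxE.
  apply/rowP => i; rewrite mxE.
  by have := coord_sum_free (fun i => (a : 'rV_6) 0 i) i (basis_free bX).
move=> u v; have FE w : F w = f w by [].
have fX k : (0 < k <= 6)%N -> F s`_(k.-1) = basis6 R k.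
  move=> k6; have k6' : (k.-1 < 6)%N by case: k k6.
  apply/rowP => i; rewrite FE !mxE eqxx /=.
  by rewrite -[s`_(k.-1)]/(X`_(Ordinal k6')) (coord_free _ _ (basis_free bX)) -!val_eqE /= inordK // eq_sym.
have -> : lie u v = \sum_(t <- flat6_table m)
   (coord6 (f u) t.1.1 * coord6 (f v) t.1.2 - coord6 (f u) t.1.2 * coord6 (f v) t.1.1) *: s`_(t.2.-1).
  rewrite {1}[u]XE {1}[v]XE linear_sumlz.
  under eq_bigr => i _.
    rewrite linearZl_LR /= linear_sumr scaler_sumr.
    under eq_bigr => j _.
      rewrite linearZr_LR /= scalerA tabE scaler_sumr.
      over.
    over.
  under eq_bigr => i _ do rewrite exchange_big /=.
  rewrite exchange_big /= big_seq [RHS]big_seq; apply: eq_bigr => -[[a b] k] tm.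
  have /andP [/andP [/= a0 ab] b6] := flat6_table_bounds tm.
  have a6 : (0 < a <= 6)%N by rewrite a0 (leq_trans (ltnW ab)).
  have b6' : (0 < b <= 6)%N by rewrite b6 (leq_trans a0 (ltnW ab)).
  transitivity ((\sum_i \sum_j coord X i u * coord X j v * ((a, b) == (i.+1, j.+1))%:R
     - \sum_i \sum_j coord X j u * coord X i v * ((a, b) == (i.+1, j.+1))%:R) *: s`_(k.-1)).
    rewrite [X in _ - X]exchange_big -sumrB scaler_suml; apply: eq_bigr => i _.
    rewrite -sumrB scaler_suml; apply: eq_bigr => j _.
    by rewrite scalerA mulrBr /=.
  by rewrite !pick_sum // /coord6 !mxE.
rewrite [LHS]linear_sum -[RHS]/(flat6_lie _ _ _) /flat6_lie big_seq [RHS]big_seq.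
apply: eq_bigr => -[[a b] k] tm; rewrite linearZ_LR; congr (_ *: _).
exact: fX (flat6_table_target tm).
Qed.

End TableIsomorphism.

(** * The five models *)

Section Models.
Variable R : realFieldType.
Implicit Types u v w : 'rV[R]_6.

Lemma coord6D u v i : coord6 (u + v) i = coord6 u i + coord6 v i.
Proof. by rewrite /coord6 mxE. Qed.
Lemma coord6Z a u i : coord6 (a *: u) i = a * coord6 u i.
Proof. by rewrite /coord6 mxE. Qed.
Lemma coord6N u i : coord6 (- u) i = - coord6 u i.
Proof. by rewrite /coord6 mxE. Qed.
Lemma coord60 i : coord6 (0 : 'rV[R]_6) i = 0.
Proof. by rewrite /coord6 mxE. Qed.
Lemma coord6_basis6 i j : (0 < i <= 6)%N -> (0 < j <= 6)%N ->
  coord6 (basis6 R i) j = (i == j)%:R.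
Proof.
case: i => [|i] //; case: j => [|j] //= hi hj.
by rewrite /coord6 /basis6 mxE eqxx /= -val_eqE /= !inordK // eq_sym.
Qed.

Lemma coord6_inj u v : (forall i, (0 < i <= 6)%N -> coord6 u i = coord6 v i) -> u = v.
Proof.
move=> uv; apply/rowP => i; have := uv i.+1; rewrite /coord6 /= inord_val; apply.
exact: ltn_ord.
Qed.

(* (i, j, c) stands for the term c (x_i^* /\ x_j^* ) of the symplectic form, and *)
(* (i, j, k, c) for the term c x_k of the product x_i . x_j.                     *)
Definition flat6_form (m : flat6_name) : seq (nat * nat * R) :=
  match m with
  | R6 | R3xH3 => [:: (6, 1, 1%R); (4, 2, 1%R); (5, 3, 1%R)]
  | G6_1 => [:: (4, 3, 1%R); (5, 2, 2%R); (6, 1, 1%R)]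
  | G6_2 => [:: (5, 3, 1%R); (6, 2, 1%R); (4, 1, 1%R)]
  | G6_3 => [:: (6, 1, 2%R); (5, 2, 1%R); (3, 4, 1%R)]
  end%N.

Definition flat6_prod (m : flat6_name) : seq (nat * nat * nat * R) :=
  match m with
  | R6 => [::]
  | R3xH3 => [:: (1, 1, 4, (1 / 3)%R); (1, 2, 6, (1 / 3)%R); (2, 1, 6, (- (2 / 3))%R)]
  | G6_1 => [:: (1, 2, 4, 1%R); (1, 3, 5, (1 / 2)%R); (3, 1, 5, (- (1 / 2))%R); (3, 2, 6, (- 1)%R)]
  | G6_2 => [:: (2, 3, 4, (- (1 / 3))%R); (3, 2, 4, (- (1 / 3))%R); (1, 2, 5, (2 / 3)%R);
      (2, 1, 5, (- (1 / 3))%R); (1, 3, 6, (2 / 3)%R); (3, 1, 6, (- (1 / 3))%R)]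
  | G6_3 => [:: (1, 1, 3, (2 / 3)%R); (2, 1, 4, (- 1)%R); (3, 1, 5, (- 1)%R); (1, 4, 6, (1 / 3)%R);
      (2, 3, 6, (1 / 2)%R); (3, 2, 6, (- (1 / 2))%R); (4, 1, 6, (- (2 / 3))%R)]
  end%N.

Definition flat6_omega m u v := \sum_(t <- flat6_form m) let: (i, j, c) := t in
  c * (coord6 u i * coord6 v j - coord6 u j * coord6 v i).

Definition flat6_product m u v : 'rV[R]_6 := \sum_(t <- flat6_prod m)
  let: (i, j, k, c) := t in (c * (coord6 u i * coord6 v j)) *: basis6 R k.

Let coord6_sum (I : Type) (r : seq I) (F : I -> 'rV[R]_6) k :
  coord6 (\sum_(t <- r) F t) k = \sum_(t <- r) coord6 (F t) k.
Proof. by rewrite /coord6 summxE. Qed.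

Lemma flat6_prod_target m t : t \in flat6_prod m -> (0 < t.1.2 <= 6)%N.
Proof. by move: t; apply/allP; case: m. Qed.

Lemma coord6_product m u v k : (0 < k <= 6)%N -> coord6 (flat6_product m u v) k =
  \sum_(t <- flat6_prod m | t.1.2 == k) t.2 * (coord6 u t.1.1.1 * coord6 v t.1.1.2).
Proof.
move=> k6; rewrite coord6_sum [RHS]big_mkcond big_seq [RHS]big_seq.
apply: eq_bigr => -[[[i j] l] c] /flat6_prod_target /= l6.
by rewrite coord6Z coord6_basis6 //; case: eqP => _; rewrite ?mulr1 ?mulr0.
Qed.

Lemma coord6_lie m u v k : (0 < k <= 6)%N -> coord6 (flat6_lie m u v) k =
  \sum_(t <- flat6_table m | t.2 == k)
    (coord6 u t.1.1 * coord6 v t.1.2 - coord6 u t.1.2 * coord6 v t.1.1).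
Proof.
move=> k6; rewrite coord6_sum [RHS]big_mkcond big_seq [RHS]big_seq.
apply: eq_bigr => -[[i j] l] /flat6_table_target /= l6.
by rewrite coord6Z coord6_basis6 //; case: eqP => _; rewrite ?mulr1 ?mulr0.
Qed.

Lemma flat6_bracket m u v : bracket (flat6_product m) u v = flat6_lie m u v.
Proof.
apply: coord6_inj => k k6; rewrite coord6D coord6N !coord6_product // coord6_lie //.
by case: m; case: k k6 => [|[|[|[|[|[|[|k]]]]]]] //= _; rewrite unlock /=; field.
Qed.

Let coord6_products m u v := (coord6_product m u v (isT : (0 < 1 <= 6)%N),
  coord6_product m u v (isT : (0 < 2 <= 6)%N), coord6_product m u v (isT : (0 < 3 <= 6)%N),
  coord6_product m u v (isT : (0 < 4 <= 6)%N), coord6_product m u v (isT : (0 < 5 <= 6)%N),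
  coord6_product m u v (isT : (0 < 6 <= 6)%N)).

(** With the product tabulated instead of computed through the inverse of [musical], its identities
    become polynomial identities in coordinates, checked model by model. *)
Lemma flat6_flat m : flat_product (V := 'rV[R]_6) (flat6_omega m) (flat6_product m).
Proof.
split.
- move=> w a u v; rewrite /flat6_omega big_distrr -big_split; apply: eq_bigr => -[[i j] c] _ /=.
  by rewrite !(coord6D, coord6Z); ring.
- move=> u v; rewrite /flat6_omega -sumrN; apply: eq_bigr => -[[i j] c] _ /=; ring.
- move=> u u0; apply: coord6_inj => i i6; rewrite coord60.
  move: (u0 (basis6 R 1)) (u0 (basis6 R 2)) (u0 (basis6 R 3)).
  move: (u0 (basis6 R 4)) (u0 (basis6 R 5)) (u0 (basis6 R 6)).
  rewrite /flat6_omega; case: (m); rewrite unlock /= !coord6_basis6 //=;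
    move=> E6 E5 E4 E3 E2 E1; case: i i6 => [|[|[|[|[|[|[|i]]]]]]] //= _; lra.
- move=> w a u v; rewrite /flat6_product scaler_sumr -big_split; apply: eq_bigr => -[[[i j] k] c] _ /=.
  by rewrite scalerA -scalerDl !(coord6D, coord6Z); congr (_ *: _); ring.
- move=> w a u v; rewrite /flat6_product scaler_sumr -big_split; apply: eq_bigr => -[[[i j] k] c] _ /=.
  by rewrite scalerA -scalerDl !(coord6D, coord6Z); congr (_ *: _); ring.
- move=> u v w; rewrite /flat6_omega; case: m; rewrite unlock /= !coord6_products;
    by rewrite unlock /=; field.
- move=> u v w; rewrite /flat6_omega; case: m; rewrite unlock /= !coord6_products;
    by rewrite unlock /=; field.
move=> u v w; apply: coord6_inj => k k6; rewrite !coord6D !coord6N !coord6_product //.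
case: m; case: k k6 => [|[|[|[|[|[|[|k]]]]]]] //= _; rewrite unlock /=;
  by rewrite ?coord6_products ?unlock /=; field.
Qed.

End Models.

(** * Transport of structure and invariants separating the models *)

Section Isomorphism.
Variables (R : realFieldType).
Implicit Types g h : lieAlgebraType R.

Lemma lie_isomorphic_sym g h : lie_isomorphic g h -> lie_isomorphic h g.
Proof.
case=> f [[f' fK f'K] fM].
have f'l : linear f' by move=> a u v; apply: (can_inj fK); rewrite linearP !f'K.
pose F := HB.pack_for {linear h -> g} f' (GRing.isLinear.Build _ _ _ _ f' f'l).
exists F; split; first by exists f.
by move=> u v; apply: (can_inj fK); rewrite fM /= !f'K.
Qed.

Lemma flat_product_pullback g (V : vectType R) om pr (f : {linear g -> V}) :
  bijective f -> @flat_product R V om pr ->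
  exists2 pr' : g -> g -> g, flat_product (fun u v => om (f u) (f v)) pr' &
    forall u v, f (pr' u v) = pr (f u) (f v).
Proof.
case=> f' fK f'K fp.
have f'l a u v : f' (a *: u + v) = a *: f' u + f' v.
  by apply: (can_inj fK); rewrite linearP !f'K.
exists (fun u v => f' (pr (f u) (f v))); last by move=> u v; rewrite f'K.
split.
- by move=> w a u v; rewrite linearP (fp_om_linl fp).
- by move=> u v; rewrite (fp_om_skew fp).
- move=> u u0; apply: (can_inj fK); rewrite linear0; apply: (fp_om_nondeg fp) => w.
  by rewrite -(f'K w).
- by move=> w a u v; rewrite linearP (fp_linl fp) f'l.
- by move=> w a u v; rewrite linearP (fp_linr fp) f'l.
- by move=> u v w; rewrite !f'K (fp_sym fp).
- by move=> u v w; rewrite !f'K (fp_cyc fp).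
by move=> u v w; apply: (can_inj fK); rewrite !linearB !f'K (fp_lsa fp).
Qed.

(** Four isomorphism invariants: [lie_triple] is the failure of two-step nilpotency, [lie_indep]
    means that some ad_u has rank at least two, and [lie_commute_dep], dependence of commuting pairs
    modulo the centre, separates [G6_1] from [G6_2]. *)
Definition lie_abelian g := forall u v : g, lie u v = 0.
Definition lie_triple g := exists u v w : g, lie u (lie v w) <> 0.
Definition lie_indep g := exists u v w : g,
  forall a b, a *: lie u v + b *: lie u w = 0 -> a = 0 /\ b = 0.
Definition lie_commute_dep g := forall u v : g, lie u v = 0 ->
  exists a b, (a != 0) || (b != 0) /\ forall w, lie w (a *: u + b *: v) = 0.

Definition flat6_type g (m : flat6_name) :=
  match m with
  | R6 => lie_abelian g
  | R3xH3 => [/\ ~ lie_abelian g, ~ lie_triple g & ~ lie_indep g]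
  | G6_1 => [/\ ~ lie_triple g, lie_indep g & lie_commute_dep g]
  | G6_2 => [/\ ~ lie_triple g, lie_indep g & ~ lie_commute_dep g]
  | G6_3 => lie_triple g
  end.

Lemma flat6_type_uniq g m m' : flat6_type g m -> flat6_type g m' -> m = m'.
Proof.
have ab3 : lie_abelian g -> ~ lie_triple g by move=> ab [u [v [w]]]; rewrite ab.
have abi : lie_abelian g -> ~ lie_indep g.
  move=> ab [u [v [w]]] /(_ 1 1); rewrite !ab !scaler0 addr0 => /(_ erefl) [/eqP].
  by rewrite oner_eq0.
have and3E A B C : [/\ A, B & C] -> A /\ B /\ C by case.
by case: m; case: m' => //= H H'; exfalso; try move/and3E: H => H; try move/and3E: H' => H'; tauto.
Qed.

Lemma flat6_type_iso g h m : lie_isomorphic g h -> flat6_type g m -> flat6_type h m.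
Proof.
have tr g1 h1 : lie_isomorphic g1 h1 -> [/\ lie_abelian g1 -> lie_abelian h1,
    lie_triple g1 -> lie_triple h1, lie_indep g1 -> lie_indep h1 &
    lie_commute_dep g1 -> lie_commute_dep h1].
  case=> f [[f' fK f'K] fM]; split.
  - by move=> ab x y; rewrite -(f'K x) -(f'K y) -fM ab linear0.
  - move=> [u [v [w uvw]]]; exists (f u), (f v), (f w); rewrite -!fM => /eqP.
    by rewrite -(linear0 f) (can_eq fK) => /eqP.
  - move=> [u [v [w uvw]]]; exists (f u), (f v), (f w) => a b.
    rewrite -!fM -!linearZ_LR -linearD => /eqP; rewrite -(linear0 f) (can_eq fK) => /eqP.
    exact: uvw.
  move=> cd x y xy; have [|a [b [ab c]]] := cd (f' x) (f' y).
    by apply: (can_inj fK); rewrite fM !f'K linear0.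
  exists a, b; split=> // w; have /(congr1 f) := c (f' w).
  by rewrite fM linear0 linearD !linearZ_LR !f'K.
move=> gh; have [t1 t2 t3 t4] := tr _ _ gh; have [s1 s2 s3 s4] := tr _ _ (lie_isomorphic_sym gh).
by case: m => //= -[p1 p2 p3]; split; tauto.
Qed.

Let coord6_lies m (u v : 'rV[R]_6) := (coord6_lie m u v (isT : (0 < 1 <= 6)%N),
  coord6_lie m u v (isT : (0 < 2 <= 6)%N), coord6_lie m u v (isT : (0 < 3 <= 6)%N),
  coord6_lie m u v (isT : (0 < 4 <= 6)%N), coord6_lie m u v (isT : (0 < 5 <= 6)%N),
  coord6_lie m u v (isT : (0 < 6 <= 6)%N)).

(** [R3xH3] has a one-dimensional derived algebra. In [G6_1] the bracket is a cross product modulo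
    the centre, so commuting vectors are dependent there; in [G6_2] the vectors x2 and x3 commute
    but are independent modulo the centre. *)
Lemma flat6_has_type m : flat6_type (flat6 R m) m.
Proof.
have lieE m' (u v : flat6 R m') : lie u v = flat6_lie m' u v by [].
have no3 m' : m' <> G6_3 -> ~ lie_triple (flat6 R m').
  move=> mN [u [v [w]]]; apply; rewrite !lieE; apply: coord6_inj => k k6.
  rewrite coord60 coord6_lie //.
  by case: m' mN u v w => // _ u v w; case: k k6 => [|[|[|[|[|[|[|k]]]]]]] //= _;
    rewrite unlock /= ?coord6_lies ?unlock //=; ring.
have ind m' i j (x y : flat6 R m') : lie (basis6 R 1 : flat6 R m') x = basis6 R i ->
    lie (basis6 R 1 : flat6 R m') y = basis6 R j -> (0 < i < j)%N -> (j <= 6)%N ->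
    lie_indep (flat6 R m').
  move=> xi yj /andP [i0 ij] j6; exists (basis6 R 1), x, y => a b; rewrite xi yj => E.
  have ji := gtn_eqF ij; have j0 := ltn_trans i0 ij.
  have i6 : (0 < i <= 6)%N by rewrite i0 (leq_trans (ltnW ij)).
  have j6' : (0 < j <= 6)%N by rewrite j0.
  have := congr1 (fun z : 'rV[R]_6 => coord6 z i) E; have := congr1 (fun z : 'rV[R]_6 => coord6 z j) E.
  rewrite /= !coord6D !coord6Z !coord60 !coord6_basis6 // !eqxx [i == j]eq_sym ji /= !mulr1 !mulr0.
  by rewrite add0r addr0 => -> ->.
have lieB m' i j (x := basis6 R i : flat6 R m') (y := basis6 R j : flat6 R m') :
    (0 < i <= 6)%N -> (0 < j <= 6)%N -> forall k, (0 < k <= 6)%N -> coord6 (lie x y) k =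
    \sum_(t <- flat6_table m' | t.2 == k) ((i == t.1.1)%:R * (j == t.1.2)%:R
       - (i == t.1.2)%:R * (j == t.1.1)%:R).
  move=> i6 j6 k k6; rewrite lieE coord6_lie // big_seq_cond [RHS]big_seq_cond.
  apply: eq_bigr => t /andP [/flat6_table_bounds /andP [/andP [a0 ab] b6] _].
  by rewrite !coord6_basis6 // ?a0 ?b6 ?(leq_trans (ltnW ab)) ?(ltn_trans a0 ab).
have lie_eq m' i j k : (0 < i <= 6)%N -> (0 < j <= 6)%N -> (0 < k <= 6)%N ->
    (forall l, (0 < l <= 6)%N ->
    \sum_(t <- flat6_table m' | t.2 == l) ((i == t.1.1)%:R * (j == t.1.2)%:R
       - (i == t.1.2)%:R * (j == t.1.1)%:R) = (k == l)%:R :> R) ->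
    lie (basis6 R i : flat6 R m') (basis6 R j : flat6 R m') = basis6 R k.
  by move=> i6 j6 k6 E; apply: coord6_inj => l l6; rewrite lieB // E // coord6_basis6.
case: m => /=.
- move=> u v; rewrite lieE; apply: coord6_inj => k k6; rewrite coord60 coord6_lie //.
  by rewrite unlock.
- split; last 1 first.
  + move=> [u [v [w]]]; rewrite !lieE => H.
    (* As both brackets are multiples of x6, t [u, v] - s [u, w] = 0 is the dependency that
       contradicts independence. *)
    pose s := coord6 (flat6_lie R3xH3 u v) 6; pose t := coord6 (flat6_lie R3xH3 u w) 6.
    have E a b : a * s + b * t = 0 -> a *: flat6_lie R3xH3 u v + b *: flat6_lie R3xH3 u w = 0.
      move=> ab; apply: coord6_inj => k k6; rewrite coord60 coord6D !coord6Z.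
      case: k k6 => [|[|[|[|[|[|[|k]]]]]]] //= _;
        by rewrite !coord6_lies unlock /= ?mulr0 ?addr0 // -ab /s /t !coord6_lies unlock /=; ring.
    have [|t0 s0] := H t (- s); first by apply: E; ring.
    have [|/eqP] := H 1 0; last by rewrite oner_eq0.
    by apply: E; rewrite t0 mul0r addr0 mul1r; lra.
  + move/(_ (basis6 R 1) (basis6 R 2)); rewrite (@lie_eq R3xH3 1 2 6) // => [|l l6].
      move/(congr1 (fun z : 'rV[R]_6 => coord6 z 6)); rewrite coord60 coord6_basis6 //.
      by move/eqP; rewrite oner_eq0.
    by case: l l6 => [|[|[|[|[|[|[|l]]]]]]] //= _; rewrite unlock /=; ring.
  + exact: no3.
- split; first exact: no3.
  + apply: (@ind G6_1 4 5 (basis6 R 2) (basis6 R 3)) => //; apply: lie_eq => // l l6;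
    by case: l l6 => [|[|[|[|[|[|[|l]]]]]]] //= _; rewrite unlock /=; ring.
  move=> u v; rewrite lieE => uv.
  have E k := congr1 (fun z : 'rV[R]_6 => coord6 z k) uv.
  move: (E 4) (E 5) (E 6); rewrite !coord6_lies !coord60 unlock /= => E4 E5 E6.
  have cent a b : [/\ a * coord6 u 1 + b * coord6 v 1 = 0, a * coord6 u 2 + b * coord6 v 2 = 0 &
      a * coord6 u 3 + b * coord6 v 3 = 0] -> forall w, lie w (a *: u + b *: v) = 0.
    move=> [z1 z2 z3] w; rewrite lieE; apply: coord6_inj => k k6; rewrite coord60.
    case: k k6 => [|[|[|[|[|[|[|k]]]]]]] //= _; rewrite coord6_lies unlock /= ?(coord6D, coord6Z) ?z1 ?z2 ?z3; ring.
  (* All 2 by 2 minors of the first three coordinates vanish, so v_i u - u_i v is central for each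
     i; an index with u_i nonzero makes it a nontrivial combination, and if there is none then u is
     central. *)
  have [u1|u1] := eqVneq (coord6 u 1) 0; last first.
    exists (coord6 v 1), (- coord6 u 1); rewrite oppr_eq0 u1 orbT; split=> //; apply: cent; split; lra.
  have [u2|u2] := eqVneq (coord6 u 2) 0; last first.
    exists (coord6 v 2), (- coord6 u 2); rewrite oppr_eq0 u2 orbT; split=> //; apply: cent; split; lra.
  have [u3|u3] := eqVneq (coord6 u 3) 0; last first.
    exists (coord6 v 3), (- coord6 u 3); rewrite oppr_eq0 u3 orbT; split=> //; apply: cent; split; lra.
  exists 1, 0; rewrite oner_eq0; split=> //; apply: cent; rewrite u1 u2 u3; split; ring.
- split; first exact: no3.
  + apply: (@ind G6_2 5 6 (basis6 R 2) (basis6 R 3)) => //; apply: lie_eq => // l l6;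
    by case: l l6 => [|[|[|[|[|[|[|l]]]]]]] //= _; rewrite unlock /=; ring.
  move/(_ (basis6 R 2) (basis6 R 3)) => [|a [b [ab /(_ (basis6 R 1))]]].
    rewrite lieE; apply: coord6_inj => k k6; rewrite coord60 -lieE lieB //.
    by case: k k6 => [|[|[|[|[|[|[|k]]]]]]] //= _; rewrite unlock /=; ring.
  rewrite lieE => E.
  move: (congr1 (fun z : 'rV[R]_6 => coord6 z 5) E) (congr1 (fun z : 'rV[R]_6 => coord6 z 6) E).
  rewrite !coord6_lies !coord60 unlock /= !coord6D !coord6Z !coord6_basis6 //= => a0 b0.
  have a00 : a = 0 by lra.
  have b00 : b = 0 by lra.
  by move: ab; rewrite a00 b00 eqxx.
exists (basis6 R 1), (basis6 R 1), (basis6 R 2).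
rewrite (@lie_eq G6_3 1 2 4) // => [|l l6]; last first.
  by case: l l6 => [|[|[|[|[|[|[|l]]]]]]] //= _; rewrite unlock /=; ring.
rewrite (@lie_eq G6_3 1 4 6) // => [|l l6]; last first.
  by case: l l6 => [|[|[|[|[|[|[|l]]]]]]] //= _; rewrite unlock /=; ring.
move/(congr1 (fun z : 'rV[R]_6 => coord6 z 6)); rewrite coord60 coord6_basis6 //.
by move/eqP; rewrite oner_eq0.
Qed.

Lemma flat6_isomorphic_uniq g m m' :
  lie_isomorphic g (flat6 R m) -> lie_isomorphic g (flat6 R m') -> m = m'.
Proof.
move=> gm gm'; apply: (@flat6_type_uniq g).
  exact: flat6_type_iso (lie_isomorphic_sym gm) (flat6_has_type m).
exact: flat6_type_iso (lie_isomorphic_sym gm') (flat6_has_type m').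
Qed.

Lemma flat6_isomorphic_flat g m : lie_isomorphic g (flat6 R m) ->
  exists omega : {skew_symmetric g}, flat_symplectic omega.
Proof.
case=> f [fbij fM]; have [pr' fp' prE] := flat_product_pullback fbij (flat6_flat R m).
apply: (flat_product_symplectic fp') => u v; apply: (bij_inj fbij).
by rewrite fM /bracket linearB !prE -/(bracket _ _ _) flat6_bracket.
Qed.

End Isomorphism.

Theorem theorem5p1 (R : realType) (g : lieAlgebraType R) (dimg : \dim {:g} = 6%N) :
  (exists omega : {skew_symmetric g}, flat_symplectic omega) <->
  (exists! m : flat6_name, lie_isomorphic g (flat6 R m)).
Proof.
split=> [[omega flat]|[m [gm _]]]; last exact: flat6_isomorphic_flat gm.
have [fp brE] := flat_symplectic_product flat.
have [m [s [fs szs tab]]] := flat_dim6_classification fp dimg.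
have gm : lie_isomorphic g (flat6 R m).
  by apply: (@table_isomorphic _ _ m s dimg); split=> // i j ij; rewrite -brE tab.
by exists m; split=> // m'; apply: flat6_isomorphic_uniq.
Qed.
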